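(* Let $q$ be a power of an odd prime $p$ and let $n=2^{e_0}p_1^{e_1}\cdots p_s^{e_s}$, where $p_1,\dots,p_s$ are distinct odd primes different from $p$ and $e_0,e_1,\dots,e_s$ are positive integers; let $n'=p_1^{e_1}\cdots p_s^{e_s}$ and let $\eta=(\eta_1,\dots,\eta_s)$ be a primitive root system modulo $n'$. Then the irreducible factorization of $X^n-1$ over $\mathbb{F}_q$ is given by \begin{align*} X^n-1=&\prod_{(y,x)\in\Sigma^+(n';q)}\prod_{d=0}^{e_0}\prod_{t\in\{0,1\}^{s_{y,d}^+}}\left(\sum_{i=0}^{\omega_y}(-1)^{\omega_y-i}\Big(\sum_{\substack{U\subseteq\{0,\dots,\omega_y-1\}\\ |U|=\omega_y-i}}\prod_{u\in U}\zeta_{r(y,x)_{d,t}^+}^{\widetilde{\mu}(y,x)_{d,t}^+q^u}\Big)X^{h(y,x)_{d,t}^+\cdot i}\right)\\ &\times\prod_{(y,x)\in\Sigma^-(n';q)}\prod_{d=0}^{e_0}\prod_{t\in\{0,1\}^{s_{y,d}^-}}\left(\sum_{i=0}^{\omega_y'}(-1)^{\omega_y'-i}\Big(\sum_{\substack{U\subseteq\{0,\dots,\omega_y'-1\}\\ |U|=\omega_y'-i}}\prod_{u\in U}\zeta_{r(y,x)_{d,t}^-}^{\widetilde{\mu}(y,x)_{d,t}^-q^u}\Big)X^{h(y,x)_{d,t}^-\cdot i}\right) \end{align*} where (1) for any $(y,x)\in\Sigma^+(n';q)$, $$\widetilde{\mu}(y,x)_{d,t}^+=\frac{1}{2^d}\Big(\eta_1^{x_1}\cdots\eta_s^{x_s}+p_1^{e_1-y_1}\cdots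 p_s^{e_s-y_s}\cdot\big(U_d(\eta^{(y,x)})+\sum_{j=1}^{s_{y,d}^+}t_j2^{d+j}\big)\Big),$$ $$r(y,x)_{d,t}^+=2^{\min\{e_0-d,v^+(y)\}}p_1^{e_1-y_1-M_{y_1}}\cdots p_s^{e_s-y_s-M_{y_s}},\qquad h(y,x)_{d,t}^+=2^{\max\{e_0-d-v^+(y),0\}}p_1^{M_{y_1}}\cdots p_s^{M_{y_s}};$$ (2) for any $(y,x)\in\Sigma^-(n';q)$, $\omega_y'=2\omega_y$ if $0\le d\le e_0-3$ and $\omega_y'=\omega_y$ if $e_0-2\le d\le e_0$, $$\widetilde{\mu}(y,x)_{d,t}^-=\frac{1}{2^d}\Big(\eta_1^{x_1}\cdots\eta_s^{x_s}+p_1^{e_1-y_1}\cdots p_s^{e_s-y_s}\cdot\big(U_d(\eta^{(y,x)})+\sum_{j=1}^{s_{y,d}^-}t_j2^{d+j+1}\big)\Big),$$ $$r(y,x)_{d,t}^-=\begin{cases} 2^{\min\{e_0-d,v^-(y)+1\}}p_1^{e_1-y_1-M_{y_1}}\cdots p_s^{e_s-y_s-M_{y_s}},&0\le d\le e_0-3;\\ 2p_1^{e_1-y_1-M_{y_1}}\cdots p_s^{e_s-y_s-M_{y_s}},&d=e_0-2\text{ or }e_0-1;\\ {p_1}^{e_1-y_1-M_{y_1}}\cdots p_s^{e_s-y_s-M_{y_s}},&d=e_0, \end{cases}$$ $$h(y,x)_{d,t}^-=\begin{cases} 2^{\max\{e_0-d-v^-(y)-1,0\}}p_1^{M_{y_1}}\cdots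 p_s^{M_{y_s}},&0\le d\le e_0-3;\\ 2p_1^{M_{y_1}}\cdots p_s^{M_{y_s}},&d=e_0-2;\\ {p_1}^{M_{y_1}}\cdots p_s^{M_{y_s}},&d=e_0-1\text{ or }e_0. \end{cases}$$
   Context: A compatible family $\{\zeta_N:\gcd(N,q)=1\}$ is fixed, where $\zeta_N$ is a primitive $N$-th root of unity in an algebraic closure of $\mathbb{F}_q$ and $\zeta_N^{N/M}=\zeta_M$ whenever $M\mid N$. ''Irreducible factorization'' means each factor lies in $\mathbb{F}_q[X]$ and is irreducible over $\mathbb{F}_q$. $v_\ell$ is the $\ell$-adic valuation; $\mathrm{ord}_N(q)$ is the multiplicative order, $\mathrm{ord}_1(q)=1$. An $s$-tuple $\eta=(\eta_1,\dots,\eta_s)$ of integers is a primitive root system modulo $n'=p_1^{e_1}\cdots p_s^{e_s}$ if for every $i$: $\eta_i$ is a primitive root modulo $p_i^{d}$ for all $d\ge1$, and $\eta_i\equiv1\pmod{p_j^{e_j}}$ for every $j\ne i$. For $0\le y_i\le e_i$ put $f_{i,y_i}=\mathrm{ord}_{p_i^{e_i-y_i}}(q)$, $g_{i,y_i}=\phi(p_i^{e_i-y_i})/f_{i,y_i}$. $\Sigma(n';q)$ is the set of $2s$-tuples of integers $(y,x)=(y_1,\dots,y_s,x_1,\dots,x_s)$ with $0\le y_i\le e_i$ and $0\le x_i\le g_{i,y_i}\gcd(\mathrm{lcm}(f_{1,y_1},\dots,f_{i-1,y_{i-1}}),f_{i,y_i})-1$ for all $i$ (for $i=1$ the gcd is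 understood to be $1$). $\eta^{(y,x)}=\eta_1^{x_1}\cdots\eta_s^{x_s}p_1^{y_1}\cdots p_s^{y_s}$; $\tau_y=\mathrm{lcm}(f_{1,y_1},\dots,f_{s,y_s})$; $m_{y_i}=\min\{e_i-y_i,1\}$; $\omega_y=\mathrm{lcm}(\mathrm{ord}_{p_1^{m_{y_1}}}(q),\dots,\mathrm{ord}_{p_s^{m_{y_s}}}(q))$; $M_{y_i}=\max\{e_i-y_i-v_{p_i}(q^{\omega_y}-1),0\}$. $\Sigma^+(n';q)$ (resp. $\Sigma^-(n';q)$) is the set of $(y,x)\in\Sigma(n';q)$ with $q^{\tau_y}\equiv1$ (resp. $3$) $\pmod4$. For an integer $\gamma$, $\varphi_{n'}(\gamma)=\sum_{k\ge0}\phi_{n',k}(\gamma)2^k$, $\phi_{n',k}(\gamma)\in\{0,1\}$, is the unique formal $2$-adic power series with $2^{i+1}\mid\gamma+n'\sum_{k=0}^i\phi_{n',k}(\gamma)2^k$ for all $i\ge0$; and for $d\ge0$, $U_d(\gamma)=\sum_{k=0}^{d-1}\phi_{n',k}(\gamma)2^k+(1-\phi_{n',d}(\gamma))2^d$. For $0\le d\le e_0$: if $(y,x)\in\Sigma^+(n';q)$, $v^+(y)=v_2(q^{\tau_y}-1)$ and $s_{y,d}^+=\min\{e_0-d-1,v^+(y)-1\}$; if $(y,x)\in\Sigma^-(n';q)$, $v^-(y)=v_2(q^{\tau_y}+1)$ and $s_{y,d}^-=\min\{e_0-d-2,v^-(y)-1\}$. When $s_{y,d}^{\pm}\le0$, $\{0,1\}^{s_{y,d}^{\pm}}$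 is the one-element set $\{0\}$ and the sums over $j$ are empty; otherwise $t=(t_1,\dots,t_{s_{y,d}^{\pm}})$. *)

(* Defs.v *)
From HB Require Import structures.
From mathcomp Require Import all_boot all_order all_algebra all_fingroup.
From mathcomp Require Import all_solvable all_field.

Set Implicit Arguments.
Unset Strict Implicit.
Unset Printing Implicit Defensive.

Import Order.TTheory GRing.Theory Num.Theory.
Local Open Scope ring_scope.

(* ord_N(a): the least k >= 1 with a ^ k = 1 mod N, for a coprime to N (see
   mult_orderP); the search range 1, ..., N suffices since ord_N(a) <= phi(N).
   In particular ord_1(a) = 1. *)
Definition mult_order (N : nat) (a : int) : nat :=
  (find (fun k : nat => (a ^+ k.+1 == 1 %[mod N%:Z])%Z) (iota 0 N)).+1.

Definition primitive_root_mod (N : nat) (a : int) : Prop :=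
  coprimez a N%:Z /\ mult_order N a = totient N.

Definition primitive_root_system (s : nat) (p e : 'I_s -> nat)
    (eta : 'I_s -> int) : Prop :=
  forall i : 'I_s,
    (forall d : nat, (1 <= d)%N -> primitive_root_mod (p i ^ d) (eta i)) /\
    (forall j : 'I_s, j != i -> (eta i = 1 %[mod (p j ^ e j)%:Z])%Z).

(* phi_sum m gamma k = \sum_(j < k) phi_{m,j}(gamma) 2^j, built one binary
   digit at a time; phi_digitP and phi_digit_unique show that, for odd m, the
   digits are the ones characterized by
   2^(i+1) | gamma + m * \sum_(k <= i) phi_{m,k}(gamma) 2^k for all i. *)
Fixpoint phi_sum (m : nat) (gamma : int) (k : nat) : nat :=
  if k is k'.+1 then
    let S := phi_sum m gamma k' in
    let b : bool := ~~ ((2 ^ k'.+1)%N%:Z %| gamma + (m * S)%N%:Z)%Z in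
    (S + b * 2 ^ k')%N
  else 0%N.

Definition phi_digit (m : nat) (gamma : int) (k : nat) : bool :=
  ~~ ((2 ^ k.+1)%N%:Z %| gamma + (m * phi_sum m gamma k)%N%:Z)%Z.

Definition U_ (m : nat) (gamma : int) (d : nat) : nat :=
  (\sum_(k < d) phi_digit m gamma k * 2 ^ k
     + (1 - phi_digit m gamma d) * 2 ^ d)%N.

Section Factorization.

Variables (q e0 s : nat) (p e : 'I_s -> nat) (eta : 'I_s -> int).

Definition nprime : nat := (\prod_(i < s) p i ^ e i)%N.

Definition ford (i : 'I_s) (yi : nat) : nat :=
  mult_order (p i ^ (e i - yi)) q%:Z.

Definition gind (i : 'I_s) (yi : nat) : nat :=
  (totient (p i ^ (e i - yi)) %/ ford i yi)%N.

(* For the first index the lcm is empty, hence 1, and so is the gcd. *)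
Definition in_Sigma (y x : 'I_s -> nat) : bool :=
  [forall i : 'I_s, (y i <= e i)%N &&
     (x i < gind i (y i) *
            gcdn (\big[lcmn/1%N]_(j < s | (j < i)%N) ford j (y j))
                 (ford i (y i)))%N].

(* All entries of the tuples in Sigma(n'; q) are at most n' (in_Sigma_le), so
   that Sigma(n'; q) is a set of pairs over the following finite type. *)
Definition exps : finType := {ffun 'I_s -> 'I_nprime.+1}.

Definition Sigma : {set exps * exps} :=
  [set yx : exps * exps |
     in_Sigma (fun i => yx.1 i : nat) (fun i => yx.2 i : nat)].

Definition tau (y : exps) : nat := \big[lcmn/1%N]_(i < s) ford i (y i).

Definition omega (y : exps) : nat :=
  \big[lcmn/1%N]_(i < s) mult_order (p i ^ minn (e i - y i) 1) q%:Z.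

(* Here and below, maxima with 0 are rendered by truncated subtraction. *)
Definition Mexp (y : exps) (i : 'I_s) : nat :=
  (e i - y i - logn (p i) (q ^ omega y - 1))%N.

Definition Sigma_plus : {set exps * exps} :=
  [set yx in Sigma | (q ^ tau yx.1 == 1 %[mod 4])%N].

Definition Sigma_minus : {set exps * exps} :=
  [set yx in Sigma | (q ^ tau yx.1 == 3 %[mod 4])%N].

Definition eta_x (x : exps) : int := \prod_(i < s) eta i ^+ x i.

Definition eta_yx (y x : exps) : int :=
  eta_x x * (\prod_(i < s) p i ^ y i)%N%:Z.

Definition coP (y : exps) : nat := (\prod_(i < s) p i ^ (e i - y i))%N.

Definition v_plus (y : exps) : nat := logn 2 (q ^ tau y - 1)%N.
Definition v_minus (y : exps) : nat := logn 2 (q ^ tau y + 1)%N.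

(* Truncated to 0 when the integer value is negative: {ffun 'I_0 -> bool} then
   has one element, and the sums over t are empty. *)
Definition s_plus (y : exps) (d : nat) : nat :=
  minn (e0 - d - 1) (v_plus y - 1).
Definition s_minus (y : exps) (d : nat) : nat :=
  minn (e0 - d - 2) (v_minus y - 1).

(* t j, for j : 'I_s_plus counted from 0, is t_{j+1}. The division by 2 ^ d is
   exact on Sigma(n'; q): see mu_exact. *)
Definition mu_plus (y x : exps) (d : nat) (t : {ffun 'I_(s_plus y d) -> bool})
    : int :=
  ((eta_x x + (coP y * (U_ nprime (eta_yx y x) d
     + \sum_(j < s_plus y d) t j * 2 ^ (d + j.+1)))%N%:Z) %/ (2 ^ d)%N%:Z)%Z.

Definition mu_minus (y x : exps) (d : nat)
    (t : {ffun 'I_(s_minus y d) -> bool}) : int :=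
  ((eta_x x + (coP y * (U_ nprime (eta_yx y x) d
     + \sum_(j < s_minus y d) t j * 2 ^ (d + j.+1 + 1)))%N%:Z)
     %/ (2 ^ d)%N%:Z)%Z.

Definition r_odd (y : exps) : nat :=
  (\prod_(i < s) p i ^ (e i - y i - Mexp y i))%N.
Definition h_odd (y : exps) : nat := (\prod_(i < s) p i ^ Mexp y i)%N.

Definition r_plus (y : exps) (d : nat) : nat :=
  (2 ^ minn (e0 - d) (v_plus y) * r_odd y)%N.
Definition h_plus (y : exps) (d : nat) : nat :=
  (2 ^ (e0 - d - v_plus y) * h_odd y)%N.

(* The conditions d <= e0 - 3, d = e0 - 2, d = e0 - 1 are over the integers,
   hence the additive form of the tests. *)
Definition omega_minus (y : exps) (d : nat) : nat :=
  if (d + 3 <= e0)%N then (2 * omega y)%N else omega y.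

Definition r_minus (y : exps) (d : nat) : nat :=
  if (d + 3 <= e0)%N then (2 ^ minn (e0 - d) (v_minus y + 1) * r_odd y)%N
  else if (d + 2 == e0)%N || (d + 1 == e0)%N then (2 * r_odd y)%N
  else r_odd y.

Definition h_minus (y : exps) (d : nat) : nat :=
  if (d + 3 <= e0)%N then (2 ^ (e0 - d - v_minus y - 1) * h_odd y)%N
  else if (d + 2 == e0)%N then (2 * h_odd y)%N
  else h_odd y.

Section Factors.

Variables (L : fieldType) (zeta : nat -> L).

Definition factor (w r h : nat) (mu : int) : {poly L} :=
  \sum_(i < w.+1)
     ((-1) ^+ (w - i) *
      \sum_(U : {set 'I_w} | #|U| == (w - i)%N)
         \prod_(u in U) zeta r ^ (mu * (q ^ u)%N%:Z)) *: 'X^(h * i).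

Definition factor_plus (yx : exps * exps) (d : nat)
    (t : {ffun 'I_(s_plus yx.1 d) -> bool}) : {poly L} :=
  factor (omega yx.1) (r_plus yx.1 d) (h_plus yx.1 d) (mu_plus yx.2 t).

Definition factor_minus (yx : exps * exps) (d : nat)
    (t : {ffun 'I_(s_minus yx.1 d) -> bool}) : {poly L} :=
  factor (omega_minus yx.1 d) (r_minus yx.1 d) (h_minus yx.1 d)
    (mu_minus yx.2 t).

End Factors.

End Factorization.

Definition compatible_roots (q : nat) (L : fieldType) (zeta : nat -> L) : Prop :=
  (forall N : nat, coprime N q -> N.-primitive_root (zeta N)) /\
  (forall M N : nat, coprime N q -> (M %| N)%N ->
     zeta N ^+ (N %/ M) = zeta M).

Definition irreducible_over (F L : fieldType) (iota : {rmorphism F -> L})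
    (P : {poly L}) : Prop :=
  exists2 g : {poly F}, map_poly iota g = P & irreducible_poly g.

Lemma totient_le (N : nat) : (totient N <= N)%N.
Proof.
rewrite totient_count_coprime big_mkord -[X in (_ <= X)%N]card_ord -sum1_card.
by apply: leq_sum => i _; case: (coprime _ _).
Qed.

Lemma mult_orderP (N a : nat) : (0 < N)%N -> coprime a N ->
  [/\ (a ^ mult_order N a%:Z = 1 %[mod N])%N &
      forall k : nat, (0 < k)%N -> (a ^ k = 1 %[mod N])%N ->
        (mult_order N a%:Z <= k)%N].
Proof.
move=> N0 coaN; rewrite /mult_order.
have modE k : (a%:Z ^+ k == 1 %[mod N%:Z])%Z = (a ^ k == 1 %[mod N])%N.
  by rewrite -natz -natrX natz !modz_nat eqz_nat.
set P := (fun k : nat => _).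
have hasP : has P (iota 0 N).
  apply/hasP; exists (totient N).-1.
    by rewrite mem_iota /= add0n prednK ?totient_gt0 // totient_le.
  by rewrite /P modE prednK ?totient_gt0 //; apply/eqP/Euler_exp_totient.
have ltN : (find P (iota 0 N) < N)%N.
  by rewrite -[X in (_ < X)%N](size_iota 0 N) -has_find.
split.
- have := nth_find 0%N hasP.
  by rewrite nth_iota // add0n /P modE => /eqP.
- case=> // k _ Hk; rewrite ltnS leqNgt; apply/negP => lt_k.
  have := before_find 0%N lt_k.
  by rewrite nth_iota ?(ltn_trans lt_k) // add0n /P modE Hk eqxx.
Qed.

Lemma phi_sumE (m : nat) (gamma : int) (k : nat) :
  phi_sum m gamma k = (\sum_(j < k) phi_digit m gamma j * 2 ^ j)%N.
Proof.
by elim: k => [|k IH]; rewrite ?big_ord0 // big_ord_recr /= -IH.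
Qed.

Lemma dvdz_step (m : nat) (z : int) (k : nat) (b : bool) : odd m ->
  ((2 ^ k)%N%:Z %| z)%Z ->
  ((2 ^ k.+1)%N%:Z %| z + (m * (b * 2 ^ k))%N%:Z)%Z
    = (b == ~~ ((2 ^ k.+1)%N%:Z %| z)%Z).
Proof.
move=> m_odd /dvdzP[c ->].
have k0 : (2 ^ k)%N%:Z != 0 by rewrite eqz_nat -lt0n expn_gt0.
have -> : (m * (b * 2 ^ k))%N%:Z = (m * b)%N%:Z * (2 ^ k)%N%:Z.
  by rewrite -PoszM mulnA.
rewrite expnS (PoszM 2%N) -mulrDl !(@dvdz_mul2r (2 ^ k)%N%:Z) // [c](divz_eq c 2).
have : (0 <= c %% 2 < 2)%Z by rewrite modz_ge0 ?ltz_pmod.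
case: (c %% 2)%Z => // r _; rewrite -addrA.
have c2 : ((c %/ 2)%Z * 2 \in dvdz 2)%Z by exact: dvdz_mull.
rewrite !(rpredDl _ c2) -PoszD !dvdzE /= !dvdn2.
by rewrite oddD oddM m_odd; case: (odd r); case: b.
Qed.

Lemma phi_sum_dvd (m : nat) (gamma : int) (k : nat) : odd m ->
  ((2 ^ k)%N%:Z %| gamma + (m * phi_sum m gamma k)%N%:Z)%Z.
Proof.
move=> m_odd; elim: k => [|k IH]; first by rewrite dvd1z.
by rewrite /= mulnDr PoszD addrA dvdz_step.
Qed.

Lemma phi_digitP (m : nat) (gamma : int) (i : nat) : odd m ->
  ((2 ^ i.+1)%N%:Z %|
     gamma + (m * \sum_(k < i.+1) phi_digit m gamma k * 2 ^ k)%N%:Z)%Z.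
Proof. by move=> m_odd; rewrite -phi_sumE phi_sum_dvd. Qed.

Lemma phi_digit_unique (m : nat) (gamma : int) (phi : nat -> bool) : odd m ->
  (forall i : nat, ((2 ^ i.+1)%N%:Z %|
     gamma + (m * \sum_(k < i.+1) phi k * 2 ^ k)%N%:Z)%Z) ->
  phi =1 phi_digit m gamma.
Proof.
move=> m_odd Hphi.
have sumE k : (\sum_(j < k) phi j * 2 ^ j)%N = phi_sum m gamma k ->
    phi k = phi_digit m gamma k.
  move=> E; have := Hphi k; rewrite big_ord_recr /= E mulnDr PoszD addrA.
  by rewrite dvdz_step ?phi_sum_dvd // => /eqP.
move=> k; apply: (sumE); elim: k => [|k IH]; first by rewrite big_ord0.
by rewrite big_ord_recr /= IH (sumE k IH).
Qed.

Lemma in_Sigma_le (q s : nat) (p e : 'I_s -> nat) (y x : 'I_s -> nat) :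
  (forall i, (1 < p i)%N) -> in_Sigma q p e y x ->
  forall i, (y i <= nprime p e)%N && (x i <= nprime p e)%N.
Proof.
move=> p1 /forallP yxP i; have /andP[yi xi] := yxP i.
have pe_n : (p i ^ e i <= nprime p e)%N.
  rewrite /nprime (bigD1 i) //= leq_pmulr // prodn_gt0 // => j.
  by rewrite expn_gt0 ltnW.
apply/andP; split.
  by apply: leq_trans yi (leq_trans _ pe_n); apply/ltnW/ltn_expl/p1.
apply: leq_trans (ltnW xi) _.
have fi0 : (0 < ford q p e i (y i))%N by [].
apply: leq_trans (leq_mul (leqnn _) (dvdn_leq fi0 (dvdn_gcdr _ _))) _.
apply: leq_trans (leq_divM _ _) _.
apply: leq_trans (totient_le _) (leq_trans _ pe_n).
by rewrite leq_exp2l // leq_subr.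
Qed.

Lemma mu_exact (q s : nat) (p e : 'I_s -> nat) (eta : 'I_s -> int)
    (yx : exps p e * exps p e) (d w : nat) :
  (forall i, odd (p i)) -> yx \in Sigma q p e ->
  ((2 ^ d)%N%:Z %| eta_x eta yx.2 + (coP yx.1 *
     (U_ (nprime p e) (eta_yx eta yx.1 yx.2) d + w * 2 ^ d))%N%:Z)%Z.
Proof.
move=> p_odd; rewrite inE => /forallP yxP.
have prod_odd (f : 'I_s -> nat) : odd (\prod_(i < s) p i ^ f i)%N.
  by apply: (big_ind odd) => // [a b|i _]; rewrite ?oddM ?oddX ?p_odd ?orbT // => -> ->.
pose Y := (\prod_(i < s) p i ^ yx.1 i)%N.
have nE : nprime p e = (coP yx.1 * Y)%N.
  rewrite /nprime /coP /Y -big_split /=; apply: eq_bigr => i _.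
  by rewrite -expnD subnK //; have /andP[] := yxP i.
have := @phi_sum_dvd (nprime p e) (eta_yx eta yx.1 yx.2) d (prod_odd e).
rewrite /U_ -phi_sumE; set S := phi_sum _ _ _; set b := (_ - _)%N.
rewrite {1}nE /eta_yx -/Y mulnAC PoszM -mulrDl Gauss_dvdzl; last first.
  by rewrite coprimezE /= coprimeXl // coprime2n prod_odd.
move=> S_dvd; rewrite -addnA -mulnDl mulnDr PoszD addrA rpredD //.
by rewrite mulnA PoszM dvdz_mull.
Qed.

(* Main.v *)
Require Import Defs.
From HB Require Import structures.
From mathcomp Require Import all_boot all_order all_algebra all_fingroup.
From mathcomp Require Import all_solvable all_field.
From mathcomp Require Import zify ring.

Set Implicit Arguments.
Unset Strict Implicit.
Unset Printing Implicit Defensive.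

Import Order.TTheory GRing.Theory Num.Theory.
Local Open Scope ring_scope.

(* A factor is the product of the binomials X^h - a^(q^u) with u < w, where
   a = zeta_r^mu; if beta = zeta_N^mu with N = r h, it has the roots beta^(q^i)
   for i < w h.  Lifting the exponent gives ord_N(q) = w h for
   N = 2^(e0 - d) p_1^(e_1 - y_1) ... p_s^(e_s - y_s), so these roots are the
   distinct conjugates of beta, and the factor is the minimal polynomial of
   beta.  Different indices (y, x, d, t) give beta's that are not conjugate: the
   order of beta determines y and d, a congruence modulo p_1, ..., p_s in turn
   determines x, and one modulo a power of 2 determines t.  The numbers of
   indices and of conjugates then add up to n, so that every n-th root of unity
   is a root of exactly one factor. *)

(** * Orders modulo N and lifting the exponent *)

(** The exponents come from the Chinese remainder theorem: [beta] is zeta_n raised to an exponent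
    congruent to eta^(y,x) modulo n' and of 2-adic valuation d. The digits phi expand -eta^(y,x)/n'
    in the 2-adic integers; [U_] flips the d-th one, so that the valuation is exactly d and [mu] is
    odd. The gcd in the bound on x_i: conjugacy by q^K, once settled modulo the earlier primes,
    leaves only K divisible by D = lcm(f_1, ..., f_(i-1)), and q^D generates a subgroup of index g_i
    gcd(D, f_i) in the units modulo p_i^(e_i - y_i). The obstacle is the prime 2. Lifting the
    exponent fails there when q^tau = 3 modulo 4, and one has to pass to the square, of valuation
    v^- + 1; hence the degree omega' = 2 omega and the v^- + 1 in r. Multiplication by q^tau then
    exchanges the classes 1 and 3 modulo 4, so that the digit at 2^(d+1) does not separate cosets
    and t starts at 2^(d+2). *)

Lemma dvdn_eqP (a b : nat) : (forall k, (a %| k) = (b %| k))%N -> a = b.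
Proof. by move=> H; apply/eqP; rewrite eqn_dvd H dvdnn -H dvdnn. Qed.

Lemma mult_order_nat_dvd (N q k : nat) : (0 < N)%N -> (0 < q)%N ->
  coprime q N -> (N %| q ^ k - 1)%N = (mult_order N q%:Z %| k)%N.
Proof.
move=> N0 q0 co; have [Ho Hmin] := mult_orderP N0 co.
have E j : (N %| q ^ j - 1)%N = (q ^ j == 1 %[mod N])%N.
  by rewrite eqn_mod_dvd // expn_gt0 q0.
set o := mult_order _ _ in Ho Hmin *.
have perE j : (q ^ j = q ^ (j %% o) %[mod N])%N.
  rewrite {1}(divn_eq j o) expnD (mulnC _ o) expnM -modnMml.
  by rewrite -(modnXm _ _ (q ^ o)%N) Ho modnXm exp1n modnMml mul1n.
rewrite E perE; apply/eqP/idP => [H|/eqP ->]; last by rewrite expn0.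
rewrite /dvdn -leqn0 leqNgt; apply/negP => lt0.
by have := Hmin _ lt0 H; rewrite leqNgt ltn_mod.
Qed.

(** Meant for the [eta i], which may be negative: the order depends only on the residue [b] of [a].
    Modulus 1 is set apart because there [b] is 0, while the version over nat wants a positive
    base. *)
Lemma mult_order_dvd (N : nat) (a : int) (k : nat) : (0 < N)%N ->
  coprimez a N%:Z -> (N%:Z %| a ^+ k - 1)%Z = (mult_order N a %| k)%N.
Proof.
move=> N0 co.
have N0z : N%:Z != 0 by rewrite eqz_nat -lt0n.
have [N1|N1] := leqP N 1.
  have -> : N = 1%N by lia.
  by rewrite dvd1z /mult_order /= !modz1 dvd1n.
pose b := `|(a %% N%:Z)%Z|%N.
have bE : b%:Z = (a %% N%:Z)%Z by rewrite /b gez0_abs // modz_ge0.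
have aE j : (a ^+ j == 1 %[mod N%:Z])%Z = (b%:Z ^+ j == 1 %[mod N%:Z])%Z.
  by rewrite bE modzXm.
have co' : coprime b N.
  by move: co; rewrite /coprimez -gcdz_modl -bE.
have b0 : (0 < b)%N.
  by rewrite lt0n; apply/eqP => b0; move: co'; rewrite b0 /coprime gcd0n; lia.
have -> : mult_order N a = mult_order N b%:Z.
  by rewrite /mult_order; congr _.+1; apply: eq_find => j /=; rewrite aE.
rewrite -mult_order_nat_dvd // -eqz_mod_dvd aE.
rewrite -eqn_mod_dvd ?expn_gt0 ?b0 //.
by rewrite -natz -natrX natz !modz_nat eqz_nat.
Qed.

(* Raising to the power f / gcd (D, f) kills q ^+ K, whatever the discrete
   logarithm of q to the base rho. *)
Lemma primitive_root_transversal (N : nat) (rho : int) (q D K x x' : nat) :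
    (0 < N)%N -> (0 < q)%N -> coprime q N -> primitive_root_mod N rho ->
    (D %| K)%N ->
    let f := mult_order N q%:Z in
    (x < totient N %/ f * gcdn D f)%N -> (x' < totient N %/ f * gcdn D f)%N ->
    (N%:Z %| rho ^+ x - rho ^+ x' * q%:Z ^+ K)%Z ->
  x = x' /\ (f %| K)%N.
Proof.
move=> N0 q0 coq [cor orho] DK f.
have f0 : (0 < f)%N by [].
have fdvd j : (N%:Z %| q%:Z ^+ j - 1)%Z = (f %| j)%N by rewrite mult_order_dvd.
have fdvdn j : (N %| q ^ j - 1)%N = (f %| j)%N by rewrite mult_order_nat_dvd.
move: f f0 fdvd fdvdn => f f0 fdvd fdvdn.
have [g gE] : exists g, g = gcdn D f by exists (gcdn D f).
rewrite -gE => ltx ltx' H.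
have g0 : (0 < g)%N by rewrite gE gcdn_gt0 f0 orbT.
have [m fE] : exists m, f = (g * m)%N.
  by exists (f %/ g)%N; rewrite mulnC divnK // gE dvdn_gcdr.
have m0 : (0 < m)%N by move: f0; rewrite fE muln_gt0 => /andP[].
have fKm : (f %| K * m)%N.
  by rewrite fE dvdn_mul // (dvdn_trans _ DK) // gE dvdn_gcdl.
have ftot : (f %| totient N)%N.
  rewrite -fdvdn -eqn_mod_dvd ?expn_gt0 ?q0 //.
  by apply/eqP/Euler_exp_totient.
have totE : totient N = (totient N %/ f * g * m)%N by rewrite -mulnA -fE divnK.
have Hm : (N%:Z %| rho ^+ (x * m) - rho ^+ (x' * m))%Z.
  have -> : rho ^+ (x * m) - rho ^+ (x' * m) =
     (rho ^+ (x * m) - (rho ^+ x' * q%:Z ^+ K) ^+ m)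
     + rho ^+ (x' * m) * (q%:Z ^+ (K * m) - 1).
    by rewrite exprMn -!exprM; ring.
  rewrite rpredD //; last by rewrite dvdz_mull // fdvd.
  by rewrite exprM subrXX dvdz_mulr.
(* Since totient N = (totient N / f) g m, the power [rho ^+ m] has order (totient N / f) g, the
   common bound on [x] and [x']; its powers below that bound are distinct. *)
have key (a b : nat) : (a <= b)%N -> (b < totient N %/ f * g)%N ->
    (N%:Z %| rho ^+ (a * m) - rho ^+ (b * m))%Z -> a = b.
  move=> ab bl; have -> : (b * m = a * m + (b - a) * m)%N.
    by rewrite -mulnDl subnKC.
  rewrite exprD -{1}[rho ^+ (a * m)]mulr1 -mulrBr Gauss_dvdzr; last first.
    by rewrite coprimez_sym coprimezXl.
  rewrite -opprB rpredN mult_order_dvd // orho totE dvdn_pmul2r //.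
  case: (posnP (b - a)) => [/eqP|ba0].
    by rewrite subn_eq0 => ba _; apply/eqP; rewrite eqn_leq ab.
  by move=> /(dvdn_leq ba0); rewrite leqNgt (leq_ltn_trans (leq_subr a b) bl).
have xx : x = x'.
  case: (leqP x x') => [le|/ltnW le]; first exact: key.
  apply/esym/key => //; by rewrite -opprB rpredN.
split=> //; move: H; rewrite xx -{1}[rho ^+ x']mulr1 -mulrBr Gauss_dvdzr; last first.
  by rewrite coprimez_sym coprimezXl.
by rewrite -opprB rpredN fdvd.
Qed.

Lemma expn_sub1 (Q k : nat) : (Q ^ k - 1 = (Q - 1) * \sum_(i < k) Q ^ i)%N.
Proof. by rewrite !subn1 predn_exp. Qed.

Lemma sum_expn_mod (p Q k : nat) : (0 < Q)%N -> (p %| Q - 1)%N ->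
  (\sum_(i < k) Q ^ i = k %[mod p])%N.
Proof.
move=> Q0 pQ; have Q1 : (Q = 1 %[mod p])%N.
  by apply/eqP; rewrite eqn_mod_dvd.
elim: k => [|k IH]; first by rewrite big_ord0.
rewrite big_ord_recr /= -modnDm IH -(modnXm k) Q1 modnXm exp1n modnDm.
by rewrite addn1.
Qed.

(** With Q = 1 + c p, each Q^i is 1 + i c p modulo p^2, and the linear terms add up to c p binom(p,
    2), a multiple of p^2 for odd p. For p = 2 this binomial is 1, whence the condition on 4. The
    sum thus has p-adic valuation exactly 1. *)
Lemma sum_expn_prime (p Q : nat) : prime p -> (0 < Q)%N -> (p %| Q - 1)%N ->
  (p = 2 -> 4 %| Q - 1)%N -> exists E, (\sum_(i < p) Q ^ i = p * (1 + p * E))%N.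
Proof.
move=> pp Q0 /dvdnP[c Qc] p2.
have QE : (Q = 1 + c * p)%N by lia.
have [p2E|pN2] := eqVneq p 2%N.
  have /dvdnP[b Qb] := p2 p2E; exists b.
  rewrite p2E !big_ord_recl big_ord0 /= /bump /=; lia.
have H i : exists d, (Q ^ i = 1 + i * (c * p) + p * (p * d))%N.
  elim: i => [|i [d IH]]; first by exists 0%N; rewrite !muln0 expn0.
  exists (d * Q + i * c * c)%N; rewrite expnS IH QE; ring.
have Hs m : exists D,
    (\sum_(i < m) Q ^ i = m + (\sum_(i < m) i) * (c * p) + p * (p * D))%N.
  elim: m => [|m [D IH]]; first by exists 0%N; rewrite !big_ord0 !muln0.
  have [d Hd] := H m; exists (D + d)%N.
  rewrite !big_ord_recr /= IH Hd; ring.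
have [D ->] := Hs p.
have : (p %| \sum_(i < p) i)%N.
  rewrite -(big_mkord xpredT id) bin2_sum prime_dvd_bin //=.
  by rewrite ltn_neqAle eq_sym pN2 prime_gt1.
case/dvdnP=> b ->; exists (b * c + D)%N; ring.
Qed.

(** Lifting the exponent. If p does not divide k, the geometric sum is k modulo p, a unit. Otherwise
    one factor p of k moves into the base, Q^(p j) = (Q^p)^j, and by [sum_expn_prime] it adds
    exactly 1 to the valuation. *)
Lemma logn_expn_sub1 (p Q k : nat) : prime p -> (1 < Q)%N -> (p %| Q - 1)%N ->
  (p = 2 -> 4 %| Q - 1)%N -> (0 < k)%N ->
  logn p (Q ^ k - 1) = (logn p (Q - 1) + logn p k)%N.
Proof.
move=> pp; have p1 := prime_gt1 pp.
have [m] := ubnP k; elim: m k Q => // m IH k Q /ltnSE km Q1 pQ p2 k0.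
have sum0 j : (0 < j)%N -> (0 < \sum_(i < j) Q ^ i)%N.
  by case: j => // j _; rewrite big_ord_recl expn0.
have dvd_step j d : (d %| Q - 1)%N -> (d %| Q ^ j - 1)%N.
  by move=> dQ; rewrite expn_sub1 dvdn_mulr.
have [/dvdnP[j kE]|pk] := boolP (p %| k)%N; last first.
  rewrite expn_sub1 lognM ?sum0 ?subn_gt0 //; congr addn.
  rewrite [RHS]lognE (negPf pk) !andbF.
  rewrite lognE /dvdn (sum_expn_mod _ (ltnW Q1) pQ) -/(dvdn p k) (negPf pk).
  by rewrite !andbF.
have j0 : (0 < j)%N by move: k0; rewrite kE muln_gt0 => /andP[].
have jk : (j < m)%N by apply: leq_trans km; rewrite kE ltn_Pmulr.
rewrite kE mulnC expnM IH //; last 3 first.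
- by rewrite -(exp1n p) ltn_exp2r // prime_gt0.
- exact: dvd_step.
- by move=> /p2; apply: dvd_step.
have [E HE] := sum_expn_prime pp (ltnW Q1) pQ p2.
rewrite expn_sub1 HE lognM ?subn_gt0 ?muln_gt0 ?(prime_gt0 pp) //.
rewrite (@lognM p p (1 + _)%N) ?(prime_gt0 pp) // (@lognM p p j) ?(prime_gt0 pp) //.
suff -> : logn p (1 + p * E) = 0%N by lia.
by rewrite lognE dvdn_addl ?dvdn_mulr // dvdn1 eqn_leq [(p <= 1)%N]leqNgt p1 !andbF.
Qed.

(* v_p (Q ^ k - 1) = v_p (Q - 1) + v_p k read as an order computation. *)
Lemma pfactor_dvd_expn_sub1 (p Q a k : nat) : prime p -> (1 < Q)%N ->
  (p %| Q - 1)%N -> (p = 2 -> 4 %| Q - 1)%N ->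
  (p ^ a %| Q ^ k - 1)%N = (p ^ (a - logn p (Q - 1)) %| k)%N.
Proof.
move=> pp Q1 pQ p2; case: (posnP k) => [->|k0]; first by rewrite !dvdn0.
have Qk : (0 < Q ^ k - 1)%N by rewrite subn_gt0 -(exp1n k) ltn_exp2r.
rewrite !pfactor_dvdn // logn_expn_sub1 //; lia.
Qed.

Lemma sqrn_odd_mod4 (Q : nat) : odd Q -> (Q ^ 2 = 1 %[mod 4])%N.
Proof.
move=> oQ; have QE : Q = (1 + 2 * Q./2)%N by rewrite mul2n -{1}(odd_double_half Q) oQ.
move: (Q./2) QE => m ->.
have -> : ((1 + 2 * m) ^ 2 = (m * m + m) * 4 + 1)%N by ring.
by rewrite modnMDl.
Qed.

Lemma expn_odd_mod4 (Q h : nat) : odd Q -> odd h -> (Q ^ h = Q %[mod 4])%N.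
Proof.
move=> oQ oh; rewrite -(odd_double_half h) oh add1n expnS -mul2n expnM.
by rewrite -modnMmr -modnXm sqrn_odd_mod4 // modnXm exp1n modnMmr muln1.
Qed.

Lemma logn2_sub1_mod4 (Q : nat) : (Q = 3 %[mod 4])%N -> logn 2 (Q - 1) = 1%N.
Proof.
move=> Q3; have -> : (Q - 1 = 2 * (2 * (Q %/ 4) + 1))%N by lia.
by rewrite lognM ?addn1 // (@logn_coprime 2 (2 * _).+1) ?coprime2n ?oddS ?oddM.
Qed.

Lemma logn2_sqr_sub1 (Q : nat) : (Q = 3 %[mod 4])%N ->
  logn 2 (Q ^ 2 - 1) = (logn 2 (Q + 1)).+1.
Proof.
move=> Q3; have -> : (Q ^ 2 - 1 = (Q - 1) * (Q + 1))%N.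
  by rewrite -[X in (_ - X)%N](exp1n 2) subn_sqr.
by rewrite lognM ?logn2_sub1_mod4 //; lia.
Qed.

Lemma dvdn_pow2_sub1_mod4_1 (Q a k : nat) : (1 < Q)%N -> (Q = 1 %[mod 4])%N ->
  (2 ^ a %| Q ^ k - 1)%N = (2 ^ (a - logn 2 (Q - 1)) %| k)%N.
Proof.
move=> Q1 Q4; have d4 : (4 %| Q - 1)%N by rewrite -eqn_mod_dvd ?Q4 // ltnW.
by rewrite pfactor_dvd_expn_sub1 //; apply: dvdn_trans d4.
Qed.

(** An odd [k] gives valuation 1, since Q^k is again 3 modulo 4; for k = 2 j, lifting applies to
    Q^2, which is 1 modulo 4. The inner successor is v_2(Q - 1) = 1, the outer one is the factor 2
    of [k]. *)
Lemma dvdn_pow2_sub1_mod4_3 (Q a k : nat) : (Q = 3 %[mod 4])%N ->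
  (2 ^ a %| Q ^ k - 1)%N =
  ((if a <= 1 then 1 else 2 ^ (a - (logn 2 (Q + 1)).+1).+1) %| k)%N.
Proof.
move=> Q3; have Q1 : (1 < Q)%N by lia.
have oQ : odd Q by lia.
case: leqP => [a1|a1].
  rewrite dvd1n; apply: dvdn_trans (_ : 2 %| _)%N; first by rewrite (dvdn_exp2l 2 a1).
  by rewrite dvdn2 oddB ?expn_gt0 ?(ltnW Q1) // oddX oQ orbT.
have [ok|ek] := boolP (odd k).
  transitivity false; last first.
    apply/esym/negbTE/negP => H; have : (2 %| k)%N.
      by apply: dvdn_trans H; rewrite expnS dvdn_mulr.
    by rewrite dvdn2 ok.
  apply/negbTE/negP => H; have : (2 ^ 2 %| Q ^ k - 1)%N.
    by apply: dvdn_trans H; rewrite dvdn_exp2l.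
  rewrite -eqn_mod_dvd ?expn_gt0 ?(ltnW Q1) // (expn_odd_mod4 oQ ok).
  by rewrite -[(2 ^ 2)%N]/4%N Q3.
have [j ->] : exists j, k = (2 * j)%N by exists k./2; rewrite mul2n even_halfK.
rewrite expnM (expnS 2) dvdn_pmul2l // -logn2_sqr_sub1 // dvdn_pow2_sub1_mod4_1 //.
  by rewrite -(exp1n 2) ltn_exp2r.
exact: sqrn_odd_mod4.
Qed.

(** * Sums and products *)

Lemma dvdn_prod_coprime (I : eqType) (r : seq I) (G : I -> nat) (m : nat) :
    uniq r -> (forall i j, i != j -> coprime (G i) (G j)) ->
  (\prod_(i <- r) G i %| m)%N = all (fun i => G i %| m)%N r.
Proof.
move=> ur co; elim: r ur => [|i r IH] /=; first by rewrite big_nil dvd1n.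
case/andP=> ir ur; rewrite big_cons Gauss_dvd ?IH //.
rewrite coprime_sym; elim: r ir {ur IH} => [|j r IH].
  by rewrite big_nil coprime1n.
rewrite inE negb_or big_cons coprimeMl => /andP[ij /IH ->].
by rewrite co // eq_sym.
Qed.

Lemma binary_lt (m : nat) (b : 'I_m -> bool) :
  (\sum_(j < m) b j * 2 ^ j < 2 ^ m)%N.
Proof.
elim: m b => [|m IH] b; first by rewrite big_ord0.
rewrite big_ord_recr /= expnS; have := IH (fun j => b (widen_ord (leqnSn m) j)).
by case: (b ord_max) => /=; lia.
Qed.

Lemma binary_inj (m : nat) (b b' : 'I_m -> bool) :
  (\sum_(j < m) b j * 2 ^ j = \sum_(j < m) b' j * 2 ^ j)%N -> b =1 b'.
Proof.
elim: m b b' => [|m IH] b b'; first by move=> _ [].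
rewrite !big_ord_recr /=.
have := binary_lt (fun j => b (widen_ord (leqnSn m) j)).
have := binary_lt (fun j => b' (widen_ord (leqnSn m) j)).
have := IH (fun j => b (widen_ord (leqnSn m) j))
           (fun j => b' (widen_ord (leqnSn m) j)).
move: (\sum_(_ < m) b _ * _)%N (\sum_(_ < m) b' _ * _)%N => B B' H ltB' ltB E.
have bE : b ord_max = b' ord_max.
  by move: E; case: (b ord_max) (b' ord_max) => [] [] //=; lia.
have {}H : (fun j => b (widen_ord (leqnSn m) j)) =1
           (fun j => b' (widen_ord (leqnSn m) j)).
  by apply: H; move: E; rewrite bE => /addIn.
move=> j; case: (unliftP ord_max j) => [i ->|-> //].
have -> : lift ord_max i = widen_ord (leqnSn m) i.
  by apply: val_inj; rewrite /= /bump leqNgt ltn_ord.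
exact: H.
Qed.

Lemma big_binary (R : Type) (idx : R) (op : Monoid.com_law idx) (m : nat)
    (G : nat -> R) :
  \big[op/idx]_(t : {ffun 'I_m -> bool}) G (\sum_(j < m) t j * 2 ^ j)%N =
  \big[op/idx]_(T < 2 ^ m) G T.
Proof.
pose B (t : {ffun 'I_m -> bool}) : 'I_(2 ^ m) := Ordinal (binary_lt t).
rewrite [RHS](reindex B) //; apply/onW_bij/inj_card_bij.
  by move=> t t' /(congr1 val) /= /binary_inj E; apply/ffunP.
by rewrite card_ord card_ffun card_bool card_ord.
Qed.

(** Telescoping of gcd(a, b) lcm(a, b) = a b along the indices. The gcds in the bounds on the x_i
    thus make up exactly for tau being an lcm and not a product. *)
Lemma prod_gcd_biglcm (s : nat) (f : 'I_s -> nat) :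
  ((\prod_(i < s) gcdn (\big[lcmn/1]_(j < s | j < i) f j) (f i))
     * \big[lcmn/1]_(i < s) f i = \prod_(i < s) f i)%N.
Proof.
pose lcmf m := (\big[lcmn/1]_(j < s | j < m) f j)%N.
suff H m : (m <= s)%N ->
    ((\prod_(i < s | i < m) gcdn (lcmf i) (f i)) * lcmf m
       = \prod_(i < s | i < m) f i)%N.
  have := H s (leqnn s); rewrite /lcmf.
  by do 3![rewrite (eq_bigl (fun i : 'I_s => xpredT i) _ (fun i => ltn_ord i))].
elim: m => [|m IH] ms; first by rewrite /lcmf !big_pred0.
pose im := Ordinal ms.
have step (R : Type) (idx : R) (op : Monoid.com_law idx) (G : 'I_s -> R) :
    \big[op/idx]_(i < s | (i < m.+1)%N) G i =
    op (G im) (\big[op/idx]_(i < s | (i < m)%N) G i).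
  rewrite (bigD1 im) //=; congr (op _ _); apply: eq_bigl => i.
  by rewrite -val_eqE /= ltnS [(i < m)%N]ltn_neqAle andbC.
rewrite {2}/lcmf !step /= -/(lcmf m) -(IH (ltnW ms)) lcmnC.
rewrite mulnAC [(gcdn _ _ * _)%N]mulnC muln_lcm_gcd; ring.
Qed.

Lemma sum_totient_pfactor (p e : nat) : prime p ->
  (\sum_(j < e.+1) totient (p ^ (e - j)) = p ^ e)%N.
Proof.
move=> pp; elim: e => [|e IH]; first by rewrite big_ord1.
rewrite big_ord_recl /= subn0 (eq_bigr (fun j : 'I_e.+1 => totient (p ^ (e - j)))) //.
rewrite IH totient_pfactor //= expnS -{2}[(p ^ e)%N]mul1n -mulnDl.
by rewrite addn1 prednK // prime_gt0.
Qed.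

(** Lets the indicator of [Sigma] split over the coordinates, so that a sum over [Sigma] becomes a
    product of sums. *)
Lemma nat_of_forall (I : finType) (P : pred I) :
  nat_of_bool [forall i, P i] = (\prod_i P i)%N.
Proof.
case: forallP => [H|H]; first by rewrite big1 // => i _; rewrite H.
suff [i Pi] : exists i, ~~ P i by rewrite (bigD1 i) //= (negPf Pi) mul0n.
by apply/existsP; rewrite -negb_forall; apply/forallP.
Qed.

Lemma sum_ord_lt (m b : nat) (G : nat -> nat) : (b <= m)%N ->
  (\sum_(j < m) (j < b) * G j = \sum_(j < b) G j)%N.
Proof.
move=> bm; rewrite (big_ord_widen m G bm) [RHS]big_mkcond /=.
by apply: eq_bigr => j _; case: ltnP; rewrite ?mul1n ?mul0n.
Qed.

Lemma totient_pow2 (a : nat) : totient (2 ^ a) = (2 ^ (a - 1))%N.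
Proof. by case: a => // a; rewrite totient_pfactor //= mul1n subn1. Qed.

Lemma coprimez_dvd_sub (m m' : int) (P : nat) :
  (P%:Z %| m - m')%Z -> coprimez m P%:Z = coprimez m' P%:Z.
Proof.
by rewrite -eqz_mod_dvd /coprimez -(gcdz_modl m) => /eqP ->; rewrite gcdz_modl.
Qed.

(** The ranges of the inner indices depend on the outer ones. A single finite index type is needed
    to speak of all roots at once; the lemma serves both for the product of linear factors and for
    the count of indices. *)
Lemma sig_big_ord2 (R : Type) (idx : R) (op : Monoid.com_law idx)
    (I J : finType) (A B : I -> J -> nat) (P : pred I)
    (G : I -> J -> nat -> nat -> R) :
  \big[op/idx]_(x | P x) \big[op/idx]_y
     \big[op/idx]_(m < A x y) \big[op/idx]_(n < B x y) G x y m n =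
  \big[op/idx]_(z : {x : I & {y : J & ('I_(A x y) * 'I_(B x y))%type}} | P (tag z))
     G (tag z) (tag (tagged z)) (tagged (tagged z)).1 (tagged (tagged z)).2.
Proof.
transitivity (\big[op/idx]_(x | P x)
  \big[op/idx]_(z : {y : J & ('I_(A x y) * 'I_(B x y))%type})
     G x (tag z) (tagged z).1 (tagged z).2).
  apply: eq_bigr => x _.
  rewrite -(@sig_big_dep _ _ _ _ (fun y => ('I_(A x y) * 'I_(B x y))%type : finType)
    xpredT (fun _ _ => true) (fun y mn => G x y mn.1 mn.2)) /=.
  apply: eq_bigr => y _.
  by rewrite (pair_bigA _ (fun (m : 'I_(A x y)) (n : 'I_(B x y)) => G x y m n)).
rewrite (@sig_big_dep _ _ _ _
  (fun x => {y : J & ('I_(A x y) * 'I_(B x y))%type} : finType) P (fun _ _ => true)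
  (fun x z => G x (tag z) (tagged z).1 (tagged z).2)) /=.
by apply: eq_bigl => z; rewrite andbT.
Qed.

(** * Irreducibility of a single factor *)

Section QFrobenius.

Variables (L : fieldType) (p k : nat) (pcharL : p \in [pchar L]).

(** The proof of the characteristic is an argument so that the morphism structures, valid in
    characteristic [p], can be attached to the term [qfrob pcharL]. *)
Definition qfrob (_ : p \in [pchar L]) (x : L) : L := x ^+ (p ^ k).

Lemma qfrob_additive : zmod_morphism (qfrob pcharL).
Proof.
have pk : [pchar L].-nat (p ^ k)%N.
  by rewrite (eq_pnat _ (pcharf_eq pcharL)) pnatX pnat_id ?(pcharf_prime pcharL).
by move=> x y; rewrite /qfrob exprDn_pchar ?exprNn_pchar.
Qed.

Lemma qfrob_multiplicative : monoid_morphism (qfrob pcharL).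
Proof. by split=> [|x y]; rewrite /qfrob ?expr1n ?exprMn. Qed.

HB.instance Definition _ := GRing.isZmodMorphism.Build L L (qfrob pcharL)
  qfrob_additive.
HB.instance Definition _ := GRing.isMonoidMorphism.Build L L (qfrob pcharL)
  qfrob_multiplicative.

End QFrobenius.

(** X^#|F| - X is the product of the X - y over [F], so that its roots in [L] are the images of
    elements of [F]. *)
Lemma finField_fixed_image (F : finFieldType) (L : fieldType)
    (iota : {rmorphism F -> L}) (x : L) :
  x ^+ #|F| = x -> exists a, iota a = x.
Proof.
move=> xq; have : root (map_poly iota ('X^#|F| - 'X)) x.
  by rewrite rmorphB /= map_polyXn map_polyX rootE !hornerE xq subrr.
rewrite finField_genPoly rmorph_prod /= => rx.
have {}rx : root (\prod_(y : F) ('X - (iota y)%:P)) x.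
  by move: rx; congr (root _ x); apply: eq_bigr => y _; rewrite map_polyXsubC.
rewrite -(big_map iota predT (fun z => 'X - z%:P)) root_prod_XsubC in rx.
by case/mapP: rx => a _ ->; exists a.
Qed.

(** [U] is the set of factors from which - a_u is taken in the expansion; the inner sums are
    elementary symmetric functions. Used with P = X^h, this identifies the coefficients written in
    the theorem. *)
Lemma prod_subC_Vieta (L : fieldType) (w : nat) (a : 'I_w -> L) (P : {poly L}) :
  \prod_u (P - (a u)%:P) =
  \sum_(i < w.+1) ((-1) ^+ (w - i) *
     \sum_(U : {set 'I_w} | #|U| == (w - i)%N) \prod_(u in U) a u) *: P ^+ i.
Proof.
under eq_bigr => u _ do rewrite addrC.
rewrite bigA_distr (partition_big
  (fun U : {set 'I_w} => inord (w - #|U|) : 'I_w.+1) xpredT) //=.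
apply: eq_bigr => i _; rewrite mulr_sumr scaler_suml.
have cw (U : {set 'I_w}) : (#|U| <= w)%N.
  by rewrite -[w in X in (_ <= X)%N]card_ord max_card.
apply: eq_big => [U|U].
  rewrite -val_eqE /= inordK ?ltnS ?leq_subr //; move: (cw U) (ltn_ord i).
  by move: (nat_of_ord i) #|U| => j u; lia.
move=> /eqP/(congr1 val); rewrite /= inordK ?ltnS ?leq_subr // => Ui.
have cU : #|U| = (w - i)%N.
  by move: Ui (cw U) (ltn_ord i); move: (nat_of_ord i) #|U| => j u; lia.
rewrite (bigID (mem U)) /=.
rewrite (eq_bigr (fun u => - (a u)%:P)); last by move=> u ->.
rewrite [X in _ * X](eq_bigr (fun=> P)); last by move=> u /negPf ->.
rewrite prodrN -cU -rmorph_prod prodr_const -mul_polyC.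
rewrite rmorphM rmorphXn /= rmorphN1; congr (_ * _ ^+ _).
transitivity #|~: U|; first by apply: eq_card => u; rewrite !inE.
have := cardsC U; rewrite card_ord -Ui; move: #|U| #|~: U| => u u'; lia.
Qed.

Lemma prim_root_neq0 (L : fieldType) (N : nat) (z : L) :
  N.-primitive_root z -> z != 0.
Proof.
move=> zN; apply/eqP => z0; have := prim_expr_order zN.
have N0 := prim_order_gt0 zN.
by rewrite z0 expr0n gtn_eqF // => /esym/eqP; rewrite oner_eq0.
Qed.

Lemma prim_exprz_eq1 (L : fieldType) (N : nat) (z : L) (m : int) :
  N.-primitive_root z -> (z ^ m == 1) = (N%:Z %| m)%Z.
Proof.
move=> zN; rewrite dvdzE /= (prim_order_dvd zN).
by case: m => m //; rewrite NegzE -invr_expz invr_eq1.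
Qed.

Lemma prim_exprz_eq (L : fieldType) (N : nat) (z : L) (m m' : int) :
  N.-primitive_root z -> (z ^ m == z ^ m') = (N%:Z %| m - m')%Z.
Proof.
move=> zN; have z0 := prim_root_neq0 zN.
rewrite -(prim_exprz_eq1 _ zN) expfzDr // -invr_expz.
rewrite -[in LHS](inj_eq (mulIf (invr_neq0 (expfz_neq0 m' z0)))).
by rewrite divff // expfz_neq0.
Qed.

Lemma prim_exprz (L : fieldType) (N : nat) (z : L) (m : int) :
  N.-primitive_root z -> coprimez m N%:Z -> N.-primitive_root (z ^ m).
Proof.
move=> zN co; have N0 : N%:Z != 0 by rewrite eqz_nat -lt0n (prim_order_gt0 zN).
have mE : `|(m %% N%:Z)%Z|%N%:Z = (m %% N%:Z)%Z by rewrite gez0_abs // modz_ge0.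
have -> : z ^ m = z ^+ `|(m %% N%:Z)%Z|%N.
  apply/eqP; rewrite exprnP (prim_exprz_eq _ _ zN) mE -eqz_mod_dvd.
  by rewrite modz_mod.
rewrite prim_root_exp_coprime //.
by move: co; rewrite /coprimez -gcdz_modl -mE.
Qed.

Lemma prim_root_expn_sub (L : fieldType) (N q i j : nat) (z : L) :
    (0 < q)%N -> coprime N q -> N.-primitive_root z -> (i <= j)%N ->
  (z ^+ (q ^ i) == z ^+ (q ^ j)) = (N %| q ^ (j - i) - 1)%N.
Proof.
move=> q0 co zN ij; rewrite (eq_prim_root_expr zN) eq_sym eqn_mod_dvd; last first.
  by case: q q0 {co} => // q _; rewrite leq_pexp2l.
rewrite -{1}(subnKC ij) expnD -{2}[(q ^ i)%N]muln1 -mulnBr.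
by rewrite Gauss_dvdr // coprimeXr.
Qed.

Lemma poly_fixed_image (F : finFieldType) (L : fieldType)
    (iota : {rmorphism F -> L}) (f : {poly L}) :
  (forall i, f`_i ^+ #|F| = f`_i) -> exists g, map_poly iota g = f.
Proof.
move=> fix_f; pose c i := odflt 0 [pick a | iota a == f`_i].
exists (\poly_(i < size f) c i); apply/polyP => i; rewrite coef_map coef_poly.
case: ltnP => [_|le]; last first.
  by rewrite nth_default //; apply: (rmorph0 iota).
rewrite /c; case: pickP => [a /eqP //|none] /=.
by have [a /eqP] := finField_fixed_image iota (fix_f i); rewrite none.
Qed.

Section IrreducibleFactor.

Variables (p k q : nat) (F : finFieldType) (L : fieldType).
Variables (iota : {rmorphism F -> L}) (zeta : nat -> L).
Hypotheses (p_prime : prime p) (q_def : q = (p ^ k)%N) (cardF : #|F| = q).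
Hypothesis zeta_compat : compatible_roots q zeta.

Variables (N w r h : nat) (mu : int).
Hypotheses (N_def : N = (r * h)%N) (coNq : coprime N q) (w_gt0 : (0 < w)%N).
Hypothesis ordN : forall j, (N %| q ^ j - 1)%N = (w * h %| j)%N.
Hypothesis r_dvd : (r %| q ^ w - 1)%N.
Hypothesis co_mu : coprimez mu N%:Z.

Let beta : L := zeta N ^ mu.

Let q_gt0 : (0 < q)%N. Proof. by rewrite q_def expn_gt0 prime_gt0. Qed.

Let N_gt0 : (0 < N)%N.
Proof. by case: zeta_compat => /(_ N coNq) /prim_order_gt0. Qed.

Let h_gt0 : (0 < h)%N.
Proof. by move: N_gt0; rewrite N_def muln_gt0 => /andP[]. Qed.

Let r_gt0 : (0 < r)%N.
Proof. by move: N_gt0; rewrite N_def muln_gt0 => /andP[]. Qed.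

Let beta_prim : N.-primitive_root beta.
Proof. by case: zeta_compat => /(_ N coNq) zN _; apply: prim_exprz. Qed.

Let wh_gt0 : (0 < w * h)%N. Proof. by rewrite muln_gt0 w_gt0. Qed.

Lemma conjugate_inj (i j : nat) : (i < w * h)%N -> (j < w * h)%N ->
  beta ^+ (q ^ i) = beta ^+ (q ^ j) -> i = j.
Proof.
wlog ij : i j / (i <= j)%N => [W|].
  by case: (leqP i j) => [|/ltnW] le iw jw E; [|apply/esym]; apply: W.
move=> _ jw /eqP; rewrite (prim_root_expn_sub q_gt0 coNq beta_prim) // ordN.
case: (posnP (j - i)) => [/eqP|ji0]; last by move=> /(dvdn_leq ji0); lia.
by rewrite subn_eq0 => ji _; apply/eqP; rewrite eqn_leq ij.
Qed.

Lemma conjugate_period : beta ^+ (q ^ (w * h)) = beta.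
Proof.
rewrite -[RHS]expr1; apply/eqP; rewrite eq_sym -(expn0 q).
by rewrite (prim_root_expn_sub q_gt0 coNq beta_prim) // subn0 ordN.
Qed.

Let a : L := zeta r ^ mu.

Let beta_h : beta ^+ h = a.
Proof.
case: zeta_compat => _ /(_ r N coNq) zr; rewrite /a -zr N_def ?dvdn_mulr //.
rewrite mulKn // /beta -N_def [LHS]exprnP exprz_exp mulrC -exprz_exp.
by rewrite -exprnP.
Qed.

Let a_period : a ^+ (q ^ w) = a.
Proof.
have ar : a ^+ r = 1.
  by rewrite -beta_h -exprM mulnC -N_def; apply: prim_expr_order beta_prim.
case/dvdnP: r_dvd => c Hc.
rewrite -(subnK (_ : 0 < q ^ w)%N) ?expn_gt0 ?q_gt0 //.
by rewrite addn1 exprS Hc mulnC exprM ar expr1n mulr1.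
Qed.

Lemma factor_prodXn :
  factor q zeta w r h mu = \prod_(u < w) ('X^h - (a ^+ (q ^ u))%:P).
Proof.
rewrite prod_subC_Vieta; apply: eq_bigr => i _; rewrite -exprM mulnC.
congr (_ * _ *: _); apply: eq_bigr => U _; apply: eq_bigr => u _.
by rewrite -exprz_exp.
Qed.

Lemma factor_monic : factor q zeta w r h mu \is monic.
Proof. by rewrite factor_prodXn monic_prod // => u _; apply: monicXnsubC. Qed.

Lemma size_factor : size (factor q zeta w r h mu) = (w * h).+1.
Proof.
rewrite factor_prodXn size_prod; last first.
  by move=> u _; apply/monic_neq0/monicXnsubC.
rewrite (eq_bigr (fun=> h.+1)) => [|u _]; last by rewrite size_XnsubC.
by rewrite sum_nat_const !card_ord mulnS -addnS addKn.
Qed.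

Lemma root_factor_conjugate (i : nat) :
  root (factor q zeta w r h mu) (beta ^+ (q ^ i)).
Proof.
rewrite factor_prodXn rootE horner_prod.
(* The binomial that vanishes is the one with u = i mod w, because a^(q^w) = a. *)
rewrite (bigD1 (Ordinal (ltn_pmod i w_gt0))) //= !hornerE.
rewrite -exprM mulnC exprM beta_h [i in X in X - _](divn_eq i w).
elim: (i %/ w)%N => [|m IH]; first by rewrite mul0n add0n subrr mul0r.
by rewrite mulSn -addnA expnD exprM a_period.
Qed.

(** The factor is monic of degree w h and has w h distinct known roots. *)
Lemma factor_prod_conjugates : factor q zeta w r h mu =
  \prod_(i < w * h) ('X - (beta ^+ (q ^ i))%:P).
Proof.
pose rs := [seq beta ^+ (q ^ (i : 'I_(w * h))) | i <- enum 'I_(w * h)].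
have size_rs : size rs = (w * h)%N by rewrite size_map size_enum_ord.
rewrite [LHS](@all_roots_prod_XsubC _ _ rs); last first.
- rewrite uniq_rootsE map_inj_in_uniq ?enum_uniq // => i j _ _ /conjugate_inj E.
  by apply: val_inj; apply: E.
- by apply/allP => _ /mapP[i _ ->]; apply: root_factor_conjugate.
- by rewrite size_factor size_rs.
by rewrite (monicP factor_monic) scale1r big_map big_enum.
Qed.

(** The q-Frobenius permutes the conjugates cyclically, so it fixes the coefficients, which
    therefore lie in [F]. A nonzero polynomial over [F] that vanishes at [beta] vanishes at all w h
    conjugates, hence has at least the degree of the factor. *)
Lemma factor_irreducible : irreducible_over iota (factor q zeta w r h mu).
Proof.
have pcF : p \in [pchar F] by apply: (card_finPcharP (n := k)); rewrite // cardF.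
have pcL : p \in [pchar L] by rewrite (fmorph_pchar iota).
have sE x : qfrob k pcL x = x ^+ q by rewrite /qfrob -q_def.
have fixf : map_poly (qfrob k pcL) (factor q zeta w r h mu)
          = factor q zeta w r h mu.
  rewrite factor_prod_conjugates rmorph_prod /=.
  under eq_bigr => i _ do rewrite map_polyXsubC /= sE -exprM -expnSr.
  case: (w * h)%N wh_gt0 conjugate_period => // o _ per.
  by rewrite big_ord_recr big_ord_recl /= per expn0 expr1 mulrC.
have [i|g gE] := poly_fixed_image iota (f := factor q zeta w r h mu).
  by rewrite cardF -sE -coef_map fixf.
have size_g : size g = (w * h).+1 by rewrite -(size_map_poly iota) gE size_factor.
exists g => //; apply/(@subfx_irreducibleP _ _ iota beta).
- by rewrite gE -[beta]expr1 -(expn0 q) root_factor_conjugate.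
- by rewrite -size_poly_gt0 size_g.
move=> c rc c0; rewrite size_g -(size_map_poly iota).
pose rs := [seq beta ^+ (q ^ (i : 'I_(w * h))) | i <- enum 'I_(w * h)].
have -> : (w * h)%N = size rs by rewrite size_map size_enum_ord.
apply: max_poly_roots; first by rewrite map_poly_eq0.
  apply/allP => _ /mapP[i _ ->]; elim: (i : nat) => [|j IH].
    by rewrite expn0 expr1.
  have -> : map_poly iota c = map_poly (qfrob k pcL) (map_poly iota c).
    apply/polyP => l; rewrite !coef_map /= sE -rmorphXn /= -cardF.
    by rewrite expf_card.
  by rewrite expnSr exprM -sE rootE horner_map (eqP IH) rmorph0.
rewrite map_inj_in_uniq ?enum_uniq // => i j _ _ /conjugate_inj E.
by apply: val_inj; apply: E.
Qed.

End IrreducibleFactor.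

Lemma prod_XsubC_Xn_sub_1 (L : fieldType) (n : nat) (K : finType) (P : pred K)
    (rho : K -> L) : (0 < n)%N -> {in P &, injective rho} ->
    (forall x, P x -> rho x ^+ n = 1) -> #|P| = n ->
  \prod_(x | P x) ('X - (rho x)%:P) = 'X^n - 1.
Proof.
move=> n0 rho_inj rho_n cardP; pose rs := [seq rho x | x <- enum P].
have size_rs : size rs = n by rewrite size_map -cardE.
rewrite [RHS](@all_roots_prod_XsubC _ _ rs).
- by rewrite (monicP (monic_Xn_sub_1 _ n0)) scale1r big_map big_enum.
- by rewrite size_Xn_sub_1 // size_rs.
- apply/allP => z /mapP[x]; rewrite mem_enum => Px ->.
  by rewrite rootE !hornerE rho_n // subrr.
- rewrite uniq_rootsE map_inj_in_uniq ?enum_uniq // => x y.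
  by rewrite !mem_enum; apply: rho_inj.
Qed.

(** * The cosets attached to Sigma(n'; q) *)

Section Cosets.

Variables (q s e0 : nat) (ps e : 'I_s -> nat) (eta : 'I_s -> int).
Hypotheses (q_gt1 : (1 < q)%N) (q_odd : odd q).
Hypothesis ps_prime : forall i, prime (ps i).
Hypothesis ps_odd : forall i, odd (ps i).
Hypothesis ps_inj : injective ps.
Hypothesis co_q_ps : forall i, coprime q (ps i).

Let q_gt0 : (0 < q)%N := ltnW q_gt1.

Let ps_gt0 i : (0 < ps i)%N. Proof. exact: prime_gt0. Qed.

Let co_q_psX i a : coprime q (ps i ^ a). Proof. exact: coprimeXr. Qed.

Let qX_gt1 j : (0 < j)%N -> (1 < q ^ j)%N.
Proof. by move=> j0; rewrite -(exp1n j) ltn_exp2r. Qed.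

Lemma coprime_ps_exp (a : 'I_s -> nat) i j :
  i != j -> coprime (ps i ^ a i) (ps j ^ a j).
Proof.
move=> ij; rewrite coprimeXl // coprimeXr // prime_coprime //.
by rewrite dvdn_prime2 // (inj_eq ps_inj).
Qed.

Lemma dvdn_prod_psP (a : 'I_s -> nat) (m : nat) :
  reflect (forall i, ps i ^ a i %| m)%N (\prod_(i < s) ps i ^ a i %| m)%N.
Proof.
rewrite dvdn_prod_coprime ?index_enum_uniq //; last exact: coprime_ps_exp.
apply: (iffP allP) => [H i|H i _]; last exact: H.
by apply: H; rewrite mem_index_enum.
Qed.

Lemma prod_ps_gt0 (a : 'I_s -> nat) : (0 < \prod_(i < s) ps i ^ a i)%N.
Proof. by apply: prodn_gt0 => i; rewrite expn_gt0 ps_gt0. Qed.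

Lemma prod_ps_odd (a : 'I_s -> nat) : odd (\prod_(i < s) ps i ^ a i).
Proof.
by apply: (big_ind odd) => // [x y|i _]; rewrite ?oddM ?oddX ?ps_odd ?orbT // => -> ->.
Qed.

Lemma coprime_q_prod_ps (a : 'I_s -> nat) : coprime (\prod_(i < s) ps i ^ a i) q.
Proof.
by apply: (big_ind (fun m => coprime m q)) => [|x y|i _];
  rewrite ?coprime1n // ?coprimeMl 1?coprime_sym // => -> ->.
Qed.

Lemma logn_prod_ps (a : 'I_s -> nat) (i : 'I_s) :
  logn (ps i) (\prod_(j < s) ps j ^ a j) = a i.
Proof.
rewrite (bigD1 i) //= lognM ?expn_gt0 ?ps_gt0 //; last first.
  by rewrite prodn_cond_gt0 // => j _; rewrite expn_gt0 ps_gt0.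
rewrite pfactorK // (@logn_coprime (ps i)) ?addn0 //.
apply: (big_ind (coprime (ps i))) => [|x y|j ji]; rewrite ?coprimen1 //.
  by rewrite coprimeMr => -> ->.
by have := @coprime_ps_exp (fun j' => if j' == i then 1%N else a j') i j;
  rewrite eqxx expn1 (negPf ji) eq_sym ji; apply.
Qed.

Lemma coP_sub_dvd (a b : 'I_s -> nat) : (forall i, b i <= a i)%N ->
  (\prod_(i < s) ps i ^ (a i - b i) * \prod_(i < s) ps i ^ b i
    = \prod_(i < s) ps i ^ a i)%N.
Proof.
by move=> ba; rewrite -big_split /=; apply: eq_bigr => i _; rewrite -expnD subnK.
Qed.

(** * The order of q modulo 2^(e0 - d) p_1^(e_1 - y_1) ... p_s^(e_s - y_s) *)

Section Fixed_y.

Variable y : exps ps e.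

Let Qt := (q ^ tau q y)%N.

Lemma tau_dvd (k : nat) : (coP y %| q ^ k - 1)%N = (tau q y %| k)%N.
Proof.
apply/dvdn_prod_psP/dvdn_biglcmP => [H i _|H i].
  by rewrite /ford -mult_order_nat_dvd // expn_gt0 ps_gt0.
by rewrite mult_order_nat_dvd ?expn_gt0 ?ps_gt0 //; apply: H.
Qed.

Lemma omega_gt0 : (0 < omega q y)%N.
Proof.
apply: (big_ind (fun m => 0 < m)%N) => // m m' m0 m0'.
by rewrite lcmn_gt0 m0.
Qed.

Lemma tau_gt0 : (0 < tau q y)%N.
Proof.
apply: (big_ind (fun m => 0 < m)%N) => // m m' m0 m0'.
by rewrite lcmn_gt0 m0.
Qed.

(** If y_i < e_i, then omega is a multiple of ord_(p_i)(q) and lifting applies to q^omega. If y_i =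
    e_i this may fail, but both moduli are 1. *)
Lemma psX_dvd_omega (i : 'I_s) (k : nat) :
  (ps i ^ (e i - y i) %| q ^ (omega q y * k) - 1)%N = (ps i ^ Mexp q y i %| k)%N.
Proof.
rewrite /Mexp; case: (posnP (e i - y i)) => [->|a0].
  by rewrite sub0n expn0 !dvd1n.
rewrite expnM pfactor_dvd_expn_sub1 // ?qX_gt1 ?omega_gt0 //; last first.
  by move=> p2; have := ps_odd i; rewrite p2.
rewrite mult_order_nat_dvd ?ps_gt0 ?co_q_ps //.
by apply: (biglcmn_sup i) => //; rewrite (minn_idPr a0) expn1.
Qed.

(** Omega is the order of q modulo the radical of [coP y], so it divides tau; on its multiples the
    prime powers are read off from [psX_dvd_omega]. *)
Lemma tauE : tau q y = (omega q y * h_odd q y)%N.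
Proof.
apply: dvdn_eqP => k; rewrite -tau_dvd.
have [/dvdnP[j ->]|ok] := boolP (omega q y %| k)%N; last first.
  have -> : (omega q y * h_odd q y %| k)%N = false.
    apply/negbTE; apply: contra ok => H; apply: dvdn_trans H; exact: dvdn_mulr.
  apply/negbTE; apply: contra ok => /dvdn_prod_psP H.
  apply/dvdn_biglcmP => i _; rewrite -mult_order_nat_dvd ?expn_gt0 ?ps_gt0 //.
  by apply: dvdn_trans (H i); rewrite dvdn_exp2l // geq_minl.
rewrite [(j * _)%N]mulnC dvdn_pmul2l ?omega_gt0 //.
apply/dvdn_prod_psP/dvdn_prod_psP => H i; have := H i; by rewrite psX_dvd_omega.
Qed.

Lemma Mexp_le (i : 'I_s) : (Mexp q y i <= e i - y i)%N.
Proof. exact: leq_subr. Qed.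

Lemma r_h_odd : (r_odd q y * h_odd q y = coP y)%N.
Proof. exact: (coP_sub_dvd Mexp_le). Qed.

Lemma r_odd_dvd : (r_odd q y %| q ^ omega q y - 1)%N.
Proof.
apply/dvdn_prod_psP => i; rewrite pfactor_dvdn //; last first.
  by rewrite subn_gt0 qX_gt1 // omega_gt0.
by rewrite /Mexp; move: (e i - y i)%N (logn _ _) => a v; lia.
Qed.

Lemma h_odd_odd : odd (h_odd q y).
Proof. exact: prod_ps_odd. Qed.

Definition is_plus := (q ^ tau q y == 1 %[mod 4])%N.

Let Qw := (q ^ omega q y)%N.

Let Qt_odd : odd Qt. Proof. by rewrite oddX q_odd orbT. Qed.
Let Qw_odd : odd Qw. Proof. by rewrite oddX q_odd orbT. Qed.
Let Qt_gt1 : (1 < Qt)%N. Proof. exact/qX_gt1/tau_gt0. Qed.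
Let Qw_gt1 : (1 < Qw)%N. Proof. exact/qX_gt1/omega_gt0. Qed.
Let QtE : Qt = (Qw ^ h_odd q y)%N. Proof. by rewrite -expnM -tauE. Qed.

Let Qt_mod4 : (Qt = Qw %[mod 4])%N.
Proof. by rewrite QtE expn_odd_mod4 // h_odd_odd. Qed.

Lemma is_minusE : (q ^ tau q y == 3 %[mod 4])%N = ~~ is_plus.
Proof. by rewrite /is_plus -/Qt; move: Qt_odd; move: Qt => Q; clear; lia. Qed.

Let h_odd_gt0 : (0 < h_odd q y)%N. Proof. exact: prod_ps_gt0. Qed.

Let logn2_h_odd : logn 2 (h_odd q y) = 0%N.
Proof. by rewrite logn_coprime // coprime2n h_odd_odd. Qed.

(** The quotient tau / omega is odd, so passing from q^tau to q^omega keeps the 2-adic valuation.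
    This is why [r_plus] may use v^+ although its degree is omega. *)
Lemma v_plusE : is_plus -> v_plus q y = logn 2 (Qw - 1).
Proof.
move=> /eqP; rewrite -/Qt Qt_mod4 => Q1.
have d4 : (4 %| Qw - 1)%N by rewrite -eqn_mod_dvd ?Q1 // ltnW.
rewrite /v_plus -/Qt QtE logn_expn_sub1 ?logn2_h_odd ?addn0 //.
exact: dvdn_trans d4.
Qed.

Lemma v_plus_gt1 : is_plus -> (1 < v_plus q y)%N.
Proof.
move=> /eqP Q1; rewrite /v_plus -pfactor_dvdn // ?subn_gt0 //.
by rewrite -[(2 ^ 2)%N]/4%N -eqn_mod_dvd ?Q1 // ltnW.
Qed.

Lemma v_minusE : ~~ is_plus -> (v_minus q y).+1 = logn 2 (Qw ^ 2 - 1).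
Proof.
rewrite -is_minusE => /eqP Q3; rewrite /v_minus -logn2_sqr_sub1 // -/Qt QtE.
have d4 : (4 %| Qw ^ 2 - 1)%N.
  by rewrite -eqn_mod_dvd ?sqrn_odd_mod4 // expn_gt0 ltnW.
rewrite expnAC logn_expn_sub1 ?logn2_h_odd ?addn0 //.
  by rewrite -(exp1n 2) ltn_exp2r.
exact: dvdn_trans d4.
Qed.

Lemma v_minus_gt1 : ~~ is_plus -> (1 < v_minus q y)%N.
Proof.
rewrite -is_minusE => /eqP Q3; rewrite /v_minus -pfactor_dvdn ?addn1 //.
by move: Q3; rewrite -/Qt; move: Qt => Q; lia.
Qed.

Lemma dvdn_expn_sub1_tau (a c : nat) :
    (forall k, (2 ^ a %| Qt ^ k - 1) = (c %| k))%N ->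
  forall k, (2 ^ a * coP y %| q ^ k - 1)%N = (tau q y * c %| k)%N.
Proof.
move=> H k; rewrite Gauss_dvd; last by rewrite coprimeXl // coprime2n prod_ps_odd.
rewrite tau_dvd andbC; have [/dvdnP[j ->]|tk] /= := boolP (tau q y %| k)%N.
  by rewrite [(j * _)%N]mulnC expnM H dvdn_pmul2l // tau_gt0.
by apply/esym/negbTE; apply: contra tk => H'; apply: dvdn_trans H'; apply: dvdn_mulr.
Qed.

Variable d : nat.
Hypothesis d_le : (d <= e0)%N.

(* Both families at once: the number of binary digits t_j and the parameters
   omega, r and h, for either sign. *)
Definition sdim := if is_plus then s_plus q e0 y d else s_minus q e0 y d.
Definition wdeg := if is_plus then omega q y else omega_minus q e0 y d.
Definition rord := if is_plus then r_plus q e0 y d else r_minus q e0 y d.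
Definition hexp := if is_plus then h_plus q e0 y d else h_minus q e0 y d.
Definition Nord := (2 ^ (e0 - d) * coP y)%N.

Lemma wdeg_gt0 : (0 < wdeg)%N.
Proof.
by rewrite /wdeg /omega_minus; case: ifP => _; last case: ifP => _;
  rewrite ?muln_gt0 omega_gt0.
Qed.

Lemma rord_hexp : (rord * hexp = Nord)%N.
Proof.
have mulE u v : (u + v = e0 - d ->
    2 ^ u * r_odd q y * (2 ^ v * h_odd q y) = Nord)%N.
  by rewrite /Nord => <-; rewrite expnD -r_h_odd mulnACA.
rewrite /rord /hexp; case: ifP => [_|/negbT mi].
  by apply: mulE; lia.
have v1 := v_minus_gt1 mi; rewrite /r_minus /h_minus.
case: ifP => [_|d3]; first by apply: mulE; lia.
have [d2|d2] := eqVneq (d + 2)%N e0 => /=.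
  by have := @mulE 1%N 1%N; rewrite expn1; apply; lia.
have [d1|d1] := eqVneq (d + 1)%N e0 => /=.
  by have := @mulE 1%N 0%N; rewrite expn1 expn0 mul1n; apply; lia.
have := @mulE 0%N 0%N; rewrite expn0 !mul1n; apply; lia.
Qed.

Lemma rord_dvd : (rord %| q ^ wdeg - 1)%N.
Proof.
have odd_part j : (r_odd q y %| q ^ (j * omega q y) - 1)%N.
  by rewrite mulnC expnM expn_sub1 dvdn_mulr // r_odd_dvd.
have co u : coprime (2 ^ u) (r_odd q y).
  by rewrite coprimeXl // coprime2n prod_ps_odd.
have odd1 := odd_part 1%N; rewrite mul1n in odd1.
have even1 : (2 %| q ^ omega q y - 1)%N.
  by rewrite dvdn2 oddB ?expn_gt0 ?q_gt0 // oddX q_odd orbT.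
rewrite /rord /wdeg; case: ifP => [pl|/negbT mi].
  rewrite Gauss_dvd // odd1 andbT pfactor_dvdn ?subn_gt0 //.
  by rewrite v_plusE // geq_minr.
rewrite /r_minus /omega_minus; case: ifP => _.
  rewrite Gauss_dvd // odd_part andbT mulnC expnM pfactor_dvdn ?subn_gt0.
  - by rewrite -v_minusE // addn1 geq_minr.
  - by [].
  - by rewrite -(exp1n 2) ltn_exp2r.
case: ifP => _ //; rewrite -{1}(expn1 2) Gauss_dvd // odd1 andbT //.
Qed.

(** The order of q^tau modulo 2^(e0 - d). *)
Let c2 := if is_plus then (2 ^ (e0 - d - v_plus q y))%N
  else if (e0 - d <= 1)%N then 1%N else (2 ^ (e0 - d - (v_minus q y).+1).+1)%N.

Lemma wdeg_hexp : (wdeg * hexp = tau q y * c2)%N.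
Proof.
rewrite /wdeg /hexp /c2 tauE; case: ifP => [_|/negbT mi].
  by rewrite /h_plus -mulnA [(2 ^ _ * _)%N]mulnC.
have v1 := v_minus_gt1 mi; rewrite /omega_minus /h_minus.
have [d3|d3] := leqP (d + 3) e0.
  rewrite ifF; last by lia.
  rewrite -subnDA addn1 expnS.
  by move: (omega q y) (h_odd q y) (2 ^ _)%N => A B C; ring.
(* Modulo 4 the factor 2 of the order sits in h; for d <= e0 - 3 it sits in omega'. *)
have [d2|d2] := eqVneq (d + 2)%N e0.
  have [-> ->] : (e0 - d <= 1)%N = false /\ (e0 - d - (v_minus q y).+1 = 0)%N by lia.
  by rewrite expn1 -mulnA [(2 * _)%N]mulnC.
by rewrite ifT ?muln1 //; lia.
Qed.

Lemma dvdn_Nord (k : nat) : (Nord %| q ^ k - 1)%N = (wdeg * hexp %| k)%N.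
Proof.
rewrite wdeg_hexp; apply: dvdn_expn_sub1_tau => j; rewrite /c2.
case: ifP => [/eqP pl|/negbT]; first exact: dvdn_pow2_sub1_mod4_1.
by rewrite -is_minusE => /eqP mi; rewrite dvdn_pow2_sub1_mod4_3 // /v_minus addn1.
Qed.

(** Equivalently, 2^[sdim] is the index of the subgroup generated by q^tau in the units modulo 2^(e0
    - d). *)
Lemma count_factors :
  (2 ^ sdim * (wdeg * hexp) = totient (2 ^ (e0 - d)) * tau q y)%N.
Proof.
rewrite wdeg_hexp mulnCA mulnC totient_pow2; congr (_ * _)%N.
rewrite /sdim /c2 /s_plus /s_minus; case: ifP => [/v_plus_gt1 v1|/negbT/v_minus_gt1 v1].
  by rewrite -expnD; congr (2 ^ _)%N; lia.
case: leqP => a1; last by rewrite -expnD; congr (2 ^ _)%N; lia.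
by rewrite muln1; congr (2 ^ _)%N; lia.
Qed.

Lemma dvdz_expn_sub1 (m k : nat) :
  (m%:Z %| q%:Z ^+ k - 1)%Z = (m %| q ^ k - 1)%N.
Proof.
have -> : q%:Z ^+ k - 1 = (q ^ k - 1)%N%:Z.
  by rewrite -subzn ?expn_gt0 ?q_gt0 // -!natz natrX.
by [].
Qed.

Lemma binary_digits_inj (K T T' : nat) (m m' : int) :
    (T < 2 ^ sdim)%N -> (T' < 2 ^ sdim)%N -> (tau q y %| K)%N ->
    ((0 < e0 - d)%N -> ~~ (2 %| m')%Z) ->
    m - m' = (coP y * 2 ^ (~~ is_plus).+1)%N%:Z * (T%:Z - T'%:Z) ->
    ((2 ^ (e0 - d))%N%:Z %| m - m' * q%:Z ^+ K)%Z ->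
  T = T'.
Proof.
move=> ltT ltT' /dvdnP[j KE] odd_m' mE H.
have [s0|s0] := posnP sdim; first by move: ltT ltT'; rewrite s0; lia.
have s_le : (sdim + (~~ is_plus).+1 <= e0 - d)%N.
  by move: s0; rewrite /sdim /s_plus /s_minus; case: ifP => /= _; lia.
have s_lev : (sdim.+1 <= if is_plus then v_plus q y else v_minus q y)%N.
  by move: s0; rewrite /sdim /s_plus /s_minus; case: ifP => /= _; lia.
(* It suffices that q^K = 1 modulo 2^B: then m = m' modulo 2^B, and cancelling the odd [coP y] and
   the power of 2 in m - m' leaves T = T' modulo 2^[sdim]. *)
set B := (sdim + (~~ is_plus).+1)%N in s_le.
have mE' : m - m' * q%:Z ^+ K = m - m' - m' * (q%:Z ^+ K - 1) by ring.
have HB : (2 ^ B %| q ^ K - 1)%N.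
  rewrite KE mulnC expnM -/Qt /B; move: s_lev.
  case: ifP => [pl|/negbT mi] /= s_lev.
    rewrite dvdn_pow2_sub1_mod4_1 //; last exact/eqP.
    by rewrite -/(v_plus q y) (eqP (_ : _ - _ == 0)%N) ?expn0 ?dvd1n //; lia.
  rewrite dvdn_pow2_sub1_mod4_3; last by apply/eqP; rewrite -is_minusE in mi.
  rewrite ifF; last by lia.
  rewrite (_ : _ - _ = 0)%N; last by rewrite -addn1 -/(v_minus q y); lia.
  (* An odd multiple of tau would give m' = - m' modulo 4. *)
  rewrite expn1 dvdn2; apply/negP => oj.
  have oK : (q ^ K = 3 %[mod 4])%N.
    rewrite KE mulnC expnM -/Qt expn_odd_mod4 //.
    by apply/eqP; rewrite is_minusE.
  have : ((2 ^ 2)%N%:Z %| m' * (q%:Z ^+ K - 1))%Z.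
    have -> : m' * (q%:Z ^+ K - 1) = (m - m') - (m - m' * q%:Z ^+ K) by ring.
    rewrite rpredB //.
      by rewrite mE dvdz_mulr // dvdzE /= mi dvdn_mull.
    apply: dvdz_trans H; rewrite dvdzE /= dvdn_exp2l //.
    by move: s_le s0; rewrite /B mi /=; clear; lia.
  have -> : q%:Z ^+ K - 1 = 2%:Z * (2 * (q ^ K %/ 4) + 1)%N%:Z.
    have -> : q%:Z ^+ K = (q ^ K)%N%:Z by rewrite -!natz natrX.
    by move: (q ^ K)%N oK; clear => Q Q3; lia.
  rewrite (PoszM 2) mulrCA dvdz_mul2l // Gauss_dvdzl; last first.
    by rewrite coprimezE /= coprime2n oddD oddM.
  apply/negP/odd_m'; move: s_le s0; clear; lia.
have : ((2 ^ B)%N%:Z %| m - m')%Z.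
  have -> : m - m' = m - m' * q%:Z ^+ K + m' * (q%:Z ^+ K - 1) by ring.
  rewrite rpredD ?dvdz_mull ?dvdz_expn_sub1 //.
  by apply: dvdz_trans H; rewrite dvdzE /= dvdn_exp2l.
rewrite mE /B expnD [(coP y * _)%N]mulnC !PoszM -mulrA [_ * (_ * (_ - _))]mulrC.
rewrite dvdz_mul2r ?eqz_nat -?lt0n ?expn_gt0 // Gauss_dvdzr; last first.
  by rewrite coprimezE /= coprimeXl // coprime2n prod_ps_odd.
by rewrite -eqz_mod_dvd !modz_nat eqz_nat !modn_small // => /eqP.
Qed.

End Fixed_y.

Lemma Nord_dvd_n (y : exps ps e) (d : nat) : (forall i, y i <= e i)%N ->
  (Nord y d %| 2 ^ e0 * nprime ps e)%N.
Proof.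
move=> ye; rewrite dvdn_mul ?dvdn_exp2l ?leq_subr //.
by rewrite /nprime -(coP_sub_dvd ye) dvdn_mulr.
Qed.

Lemma coprime_Nord (y : exps ps e) (d : nat) : coprime (Nord y d) q.
Proof.
by rewrite coprimeMl coprimeXl ?coprime2n //; apply: coprime_q_prod_ps.
Qed.

(** * Coset representatives and their coprimality to the order *)

Hypothesis eta_prs : primitive_root_system ps e eta.

Lemma eta_x_mod (x : exps ps e) (i : 'I_s) :
  ((ps i ^ e i)%N%:Z %| eta_x eta x - eta i ^+ x i)%Z.
Proof.
have [r] : exists r, r = \prod_(j < s | j != i) eta j ^+ x j by eexists.
move=> rE; have r1 : (r == 1 %[mod (ps i ^ e i)%N%:Z])%Z.
  rewrite rE; apply: (big_ind (fun r => r == 1 %[mod _])%Z) => // [u v|j ji].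
    by move=> /eqP uE /eqP vE; rewrite -modzMm uE vE modzMm mulr1.
  have [_ /(_ i)] := eta_prs j; rewrite eq_sym => /(_ ji) E.
  by rewrite -modzXm E modzXm expr1n.
rewrite /eta_x (bigD1 i) //= -rE -{2}[_ ^+ _]mulr1 -mulrBr.
by rewrite dvdz_mull // -eqz_mod_dvd.
Qed.

Lemma eta_coprime (i : 'I_s) (a : nat) : coprimez (eta i) (ps i ^ a)%N%:Z.
Proof.
have [/(_ 1%N isT) [co _] _] := eta_prs i.
by rewrite coprimezE /= coprimeXr //; move: co; rewrite coprimezE /= expn1.
Qed.

(** Adds the modulus 1, which occurs when y_i = e_i. *)
Lemma primitive_root_psX (i : 'I_s) (a : nat) :
  primitive_root_mod (ps i ^ a) (eta i).
Proof.
split; first exact: eta_coprime.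
case: a => [|a]; first by rewrite expn0 /mult_order /= !modz1.
by have [/(_ a.+1 isT) []] := eta_prs i.
Qed.

(* T stands for the number with binary digits t_1, t_2, ...; c is 0 for mu^+
   and 1 for mu^-. *)
Definition coset_rep (c : nat) (y x : exps ps e) (d T : nat) : int :=
  ((eta_x eta x + (coP y * (U_ (nprime ps e) (eta_yx eta y x) d
     + 2 ^ (d + c.+1) * T))%N%:Z) %/ (2 ^ d)%N%:Z)%Z.

Section Representative.

Variables (yx : exps ps e * exps ps e) (c d T : nat).
Hypothesis yxS : yx \in Sigma q ps e.

Let mu := coset_rep c yx.1 yx.2 d T.

Lemma Sigma_le (i : 'I_s) : (yx.1 i <= e i)%N.
Proof. by move: yxS; rewrite inE => /forallP /(_ i) /andP[]. Qed.

Lemma coset_repE : (2 ^ d)%N%:Z * mu =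
  eta_x eta yx.2 + (coP yx.1 * (U_ (nprime ps e) (eta_yx eta yx.1 yx.2) d
     + 2 ^ (d + c.+1) * T))%N%:Z.
Proof.
have := @mu_exact q s ps e eta yx d (2 ^ c.+1 * T)%N ps_odd yxS.
have -> : (2 ^ c.+1 * T * 2 ^ d = 2 ^ (d + c.+1) * T)%N by rewrite expnD; ring.
by move=> H; rewrite mulrC divzK.
Qed.

Lemma coset_rep_mod (i : 'I_s) :
  ((ps i ^ (e i - yx.1 i))%N%:Z %| (2 ^ d)%N%:Z * mu - eta i ^+ yx.2 i)%Z.
Proof.
rewrite coset_repE addrAC rpredD //.
  by apply: dvdz_trans (eta_x_mod _ _); rewrite dvdzE /= dvdn_exp2l ?leq_subr.
have /dvdn_prod_psP/(_ i) H := dvdnn (coP yx.1).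
by rewrite dvdzE /= dvdn_mulr.
Qed.

(** Modulo 2^(d+1) the term in [T] disappears, and [U_] differs from the first d + 1 digits by 2^d,
    so the numerator is an odd multiple of 2^d. *)
Lemma coset_rep_odd : ~~ (2 %| mu)%Z.
Proof.
apply/negP => /dvdzP[m muE].
pose Y := (\prod_(i < s) ps i ^ yx.1 i)%N.
have nE : nprime ps e = (coP yx.1 * Y)%N by rewrite /nprime -(coP_sub_dvd Sigma_le).
set gamma := eta_yx eta yx.1 yx.2.
have H := phi_sum_dvd gamma d.+1 (prod_ps_odd e : odd (nprime ps e)).
have UE : (U_ (nprime ps e) gamma d
     + phi_digit (nprime ps e) gamma d * 2 ^ d * 2
   = phi_sum (nprime ps e) gamma d.+1 + 2 ^ d)%N.
  have -> : phi_sum (nprime ps e) gamma d.+1 = (phi_sum (nprime ps e) gamma d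
    + phi_digit (nprime ps e) gamma d * 2 ^ d)%N by [].
  rewrite /U_ -phi_sumE; clear.
  by case: (phi_digit _ _ _); move: (2 ^ d)%N (phi_sum _ _ d) => D P; lia.
(* An even [mu] would give this divisibility, which contradicts n' odd. *)
have : ((2 ^ d.+1)%N%:Z %| (nprime ps e * 2 ^ d)%N%:Z)%Z.
  have gE : gamma = eta_x eta yx.2 * Y%:Z by [].
  have := coset_repE; rewrite muE -/gamma; move: UE H.
  move: (U_ _ gamma d) (phi_sum _ gamma d.+1) (nat_of_bool (phi_digit _ gamma d)).
  move=> U S b /(congr1 Posz) + /dvdzP[k].
  rewrite gE nE addnS !expnS expnD !(PoszD, PoszM).
  move: (eta_x _ _) (coP _) (2 ^ d)%N (2 ^ c)%N Y {gE nE}.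
  move=> h C D Dc Y UE kE hE.
  apply/dvdzP; exists (Y%:Z * m + b%:Z * C%:Z * Y%:Z - C%:Z * Y%:Z * Dc%:Z * T%:Z - k).
  have -> : C%:Z * Y%:Z * D%:Z =
    C%:Z * Y%:Z * (U%:Z + b%:Z * D%:Z * 2 - S%:Z) by rewrite UE; ring.
  have -> : C%:Z * Y%:Z * (U%:Z + b%:Z * D%:Z * 2 - S%:Z) =
    Y%:Z * (h + C%:Z * (U%:Z + 2 * (D%:Z * Dc%:Z) * T%:Z))
    + C%:Z * Y%:Z * (b%:Z * D%:Z * 2 - 2 * (D%:Z * Dc%:Z) * T%:Z)
    - (h * Y%:Z + C%:Z * Y%:Z * S%:Z) by ring.
  by rewrite kE -hE; ring.
by rewrite dvdzE /= expnS dvdn_pmul2r ?expn_gt0 // dvdn2 prod_ps_odd.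
Qed.

Lemma coset_rep_coprime : coprimez mu (Nord yx.1 d)%:Z.
Proof.
rewrite coprimezE /= coprimeMr; apply/andP; split.
  rewrite coprimeXr // coprimen2.
  by have := coset_rep_odd; rewrite dvdzE /= dvdn2 negbK.
apply: (big_ind (coprime `|mu|)) => [|u v|i _]; first exact: coprimen1.
  by rewrite coprimeMr => -> ->.
have := coprimez_dvd_sub (coset_rep_mod i).
rewrite coprimezXl ?eta_coprime // coprimezMl => /andP[_].
by rewrite coprimezE.
Qed.

End Representative.

(** * Distinctness and number of the cosets *)

Lemma Nord_inj (y y' : exps ps e) (d d' : nat) :
    (forall i, y i <= e i)%N -> (forall i, y' i <= e i)%N ->
    (d <= e0)%N -> (d' <= e0)%N -> Nord y d = Nord y' d' ->
  y = y' /\ d = d'.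
Proof.
move=> ye ye' de de' E.
have pos a : (0 < 2 ^ a)%N by rewrite expn_gt0.
have coPpos (z : exps ps e) : (0 < coP z)%N by apply: prod_ps_gt0.
have ad : (e0 - d = e0 - d')%N.
  have := congr1 (logn 2) E; rewrite !lognM // !pfactorK //.
  by rewrite !(@logn_coprime 2 (coP _)) ?coprime2n ?prod_ps_odd // !addn0.
split; last by lia.
apply/ffunP => i; apply: val_inj.
have := congr1 (logn (ps i)) E; rewrite !lognM // /coP !logn_prod_ps ad /=.
by move=> /addnI H; apply/eqP; rewrite -(eqn_sub2lE (ye i) (ye' i)) H.
Qed.

Definition rep (yx : exps ps e * exps ps e) (d T : nat) : int :=
  coset_rep (~~ is_plus yx.1) yx.1 yx.2 d T.

Lemma rep_inj (L : fieldType) (zeta : nat -> L)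
    (yx yx' : exps ps e * exps ps e) (d d' T T' K : nat) :
    compatible_roots q zeta ->
    yx \in Sigma q ps e -> yx' \in Sigma q ps e ->
    (d <= e0)%N -> (d' <= e0)%N ->
    (T < 2 ^ sdim yx.1 d)%N -> (T' < 2 ^ sdim yx'.1 d')%N ->
    zeta (Nord yx.1 d) ^ rep yx d T
      = (zeta (Nord yx'.1 d') ^ rep yx' d' T') ^+ (q ^ K) ->
  [/\ yx = yx', d = d' & T = T'].
Proof.
move=> [zeta_prim _] yxS yxS' de de' ltT ltT' E.
have primN z u : (Nord z u).-primitive_root (zeta (Nord z u)).
  exact/zeta_prim/coprime_Nord.
have p1 := prim_exprz (primN _ _) (coset_rep_coprime (~~ is_plus yx.1) d T yxS).
have p2 := prim_exprz (primN _ _) (coset_rep_coprime (~~ is_plus yx'.1) d' T' yxS').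
have {}p2 : (Nord yx'.1 d').-primitive_root
    ((zeta (Nord yx'.1 d') ^ rep yx' d' T') ^+ (q ^ K)).
  by rewrite prim_root_exp_coprime // coprimeXl // coprime_sym coprime_Nord.
have NE : Nord yx.1 d = Nord yx'.1 d'.
  apply: dvdn_eqP => k; rewrite (prim_order_dvd p1) (prim_order_dvd p2).
  by rewrite -[coset_rep _ _ _ _ _]/(rep yx d T) E.
have [yE dE] := Nord_inj (Sigma_le yxS) (Sigma_le yxS') de de' NE.
move: E ltT' yxS'; rewrite -dE {p1 p2 NE de'}.
case: yx yx' => [y x] [y' x'] /= in yE ltT yxS *; rewrite -{}yE {y'} => E ltT' yxS'.
have {E} H : ((Nord y d)%:Z %| rep (y, x) d T - rep (y, x') d T' * q%:Z ^+ K)%Z.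
  rewrite -(prim_exprz_eq _ _ (primN y d)) E; apply/eqP.
  have -> : q%:Z ^+ K = (q ^ K)%N%:Z by rewrite -!natz natrX.
  by rewrite -exprz_exp.
(* Strong induction on i, carrying the divisibility of [K] along with x_i: the f_j with j < i
   dividing [K] is what the gcd in the bound on x_i requires. *)
have Hx i : x i = x' i :> nat /\ (ford q ps e i (y i) %| K)%N.
  have [m] := ubnP (i : nat); elim: m i => // m IH i /ltnSE im.
  pose D := (\big[lcmn/1%N]_(j < s | (j < i)%N) ford q ps e j (y j))%N.
  have DK : (D %| K)%N.
    by apply/dvdn_biglcmP => j ji; apply: (IH j _).2; apply: leq_trans im.
  move: (yxS) (yxS'); rewrite !inE.
  move=> /forallP/(_ i)/andP[_ ltx] /forallP/(_ i)/andP[_ ltx'].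
  apply: (primitive_root_transversal (rho := eta i)) ltx ltx' _ => //.
  - by rewrite expn_gt0 ps_gt0.
  - exact: primitive_root_psX.
  (* Multiplying by 2^d replaces each representative by its residue eta_i^(x_i) modulo p_i^(e_i -
     y_i). *)
  have -> : eta i ^+ x i - eta i ^+ x' i * q%:Z ^+ K =
     (2 ^ d)%N%:Z * (rep (y, x) d T - rep (y, x') d T' * q%:Z ^+ K)
     - ((2 ^ d)%N%:Z * rep (y, x) d T - eta i ^+ x i)
     + ((2 ^ d)%N%:Z * rep (y, x') d T' - eta i ^+ x' i) * q%:Z ^+ K by ring.
  apply: rpredD; first apply: rpredB.
  - apply/dvdz_mull/(dvdz_trans _ H); rewrite dvdzE /= dvdn_mull //.
    by have /dvdn_prod_psP/(_ i) := dvdnn (coP y).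
  - exact: (coset_rep_mod _ d T yxS).
  - exact/dvdz_mulr/(coset_rep_mod _ d T' yxS').
have xE : x = x' by apply/ffunP => i; apply: val_inj; apply: (Hx i).1.
rewrite -{}xE {x'} in yxS' H Hx *; split=> //.
have tauK : (tau q y %| K)%N by apply/dvdn_biglcmP => i _; apply: (Hx i).2.
apply: (binary_digits_inj de ltT ltT' tauK
  (m := rep (y, x) d T) (m' := rep (y, x) d T')).
- by move=> _; apply: (coset_rep_odd _ _ _ yxS).
- have d0 : (2 ^ d)%N%:Z != 0 by rewrite eqz_nat -lt0n expn_gt0.
  apply: (mulfI d0); rewrite mulrBr !(coset_repE _ _ _ yxS) /=.
  move: (U_ _ _ _) => U; rewrite expnD !PoszM !PoszD !PoszM.
  rewrite opprD addrACA subrr add0r -mulrBr opprD addrACA subrr add0r -mulrBr.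
  by rewrite -!mulrA mulrCA.
- by apply: dvdz_trans H; rewrite dvdzE /= dvdn_mulr.
Qed.

(** For fixed y, the number of x times tau is the product of the g_i f_i, that is, of the
    phi(p_i^(e_i - y_i)); summing over y factors into the sums of phi over the divisors of each
    p_i^(e_i). *)
Lemma sum_tau_Sigma :
  (\sum_(yx in Sigma q ps e) tau q yx.1 = nprime ps e)%N.
Proof.
pose B (y : exps ps e) (i : 'I_s) := (gind q ps e i (y i) *
  gcdn (\big[lcmn/1%N]_(j < s | (j < i)%N) ford q ps e j (y j))
       (ford q ps e i (y i)))%N.
have ford_dvd i j : (ford q ps e i j %| totient (ps i ^ (e i - j)))%N.
  rewrite -mult_order_nat_dvd ?expn_gt0 ?ps_gt0 // -eqn_mod_dvd ?expn_gt0 ?q_gt0 //.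
  exact/eqP/Euler_exp_totient.
have ford_gt0 i j : (0 < ford q ps e i j)%N by [].
have pe_n i : (ps i ^ e i <= nprime ps e)%N.
  rewrite /nprime (bigD1 i) //= leq_pmulr // prodn_gt0 // => j.
  by rewrite expn_gt0 ps_gt0.
have B_le y i : (B y i <= (nprime ps e).+1)%N.
  apply/leqW; apply: leq_trans (pe_n i).
  apply: leq_trans (leq_mul (leqnn _) (dvdn_leq (ford_gt0 i _) (dvdn_gcdr _ _))) _.
  rewrite divnK // (leq_trans (totient_le _)) //.
  by rewrite leq_exp2l ?prime_gt1 // leq_subr.
rewrite big_mkcond /=.
rewrite (eq_bigr (fun yx : exps ps e * exps ps e =>
   (\prod_i (yx.1 i <= e i)) * tau q yx.1 * \prod_i (yx.2 i < B yx.1 i))%N); last first.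
  move=> [y x] _ /=; rewrite inE mulnAC -big_split /=.
  under eq_bigr => i _ do rewrite mulnb.
  rewrite -nat_of_forall -/(in_Sigma q ps e (fun i => y i) (fun i => x i)).
  by case: in_Sigma; rewrite ?mul1n ?mul0n.
rewrite -(pair_bigA _ (fun y x : exps ps e => (\prod_i (y i <= e i)) * tau q y *
   \prod_i (x i < B y i))%N) /=.
transitivity (\sum_(y : exps ps e)
    \prod_i ((y i <= e i) * totient (ps i ^ (e i - y i))))%N.
  apply: eq_bigr => y _.
  rewrite -big_distrr /=.
  rewrite -(bigA_distr_bigA (fun i (j : 'I__) => nat_of_bool (j < B y i)%N)).
  have -> : (\prod_i \sum_(j < (nprime ps e).+1) (j < B y i) = \prod_i B y i)%N.
    apply: eq_bigr => i _; under eq_bigr => j _ do rewrite -[nat_of_bool _]muln1.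
    by rewrite (sum_ord_lt (fun=> 1%N) (B_le y i)) sum1_card card_ord.
  rewrite [RHS]big_split /= -mulnA; congr (_ * _)%N.
  rewrite /B big_split /= mulnCA [(tau q y * _)%N]mulnC prod_gcd_biglcm.
  by rewrite -big_split /=; apply: eq_bigr => i _; rewrite divnK.
rewrite -(bigA_distr_bigA (fun i (j : 'I_(nprime ps e).+1) =>
  (j <= e i) * totient (ps i ^ (e i - j)))%N).
apply: eq_bigr => i _; rewrite -(sum_totient_pfactor (e i) (ps_prime i)).
rewrite -(@sum_ord_lt (nprime ps e).+1 _ (fun j => totient (ps i ^ (e i - j)))) // ltnS.
by apply: leq_trans (pe_n i); apply/ltnW/ltn_expl/prime_gt1.
Qed.

Lemma factor_plusE (L : fieldType) (zeta : nat -> L)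
    (yx : exps ps e * exps ps e) (d : nat)
    (t : {ffun 'I_(s_plus q e0 yx.1 d) -> bool}) :
  is_plus yx.1 -> factor_plus eta zeta t =
    factor q zeta (wdeg yx.1 d) (rord yx.1 d) (hexp yx.1 d)
      (rep yx d (\sum_(j < s_plus q e0 yx.1 d) t j * 2 ^ j)).
Proof.
move=> pl; rewrite /factor_plus /wdeg /rord /hexp /rep pl; congr factor.
rewrite /mu_plus /coset_rep big_distrr /=; congr ((_ + (_ * (_ + _))%N%:Z) %/ _)%Z.
apply: eq_bigr => j _; rewrite mulnCA -expnD; congr (_ * 2 ^ _)%N; clear; lia.
Qed.

Lemma factor_minusE (L : fieldType) (zeta : nat -> L)
    (yx : exps ps e * exps ps e) (d : nat)
    (t : {ffun 'I_(s_minus q e0 yx.1 d) -> bool}) :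
  ~~ is_plus yx.1 -> factor_minus eta zeta t =
    factor q zeta (wdeg yx.1 d) (rord yx.1 d) (hexp yx.1 d)
      (rep yx d (\sum_(j < s_minus q e0 yx.1 d) t j * 2 ^ j)).
Proof.
move=> mi; rewrite /factor_minus /wdeg /rord /hexp /rep (negPf mi); congr factor.
rewrite /mu_minus /coset_rep big_distrr /=; congr ((_ + (_ * (_ + _))%N%:Z) %/ _)%Z.
apply: eq_bigr => j _; rewrite mulnCA -expnD; congr (_ * 2 ^ _)%N; clear; lia.
Qed.

End Cosets.

Theorem theorem4p2
  (p k q : nat) (p_prime : prime p) (p_odd : odd p) (k_gt0 : (0 < k)%N)
  (q_def : q = (p ^ k)%N)
  (F : finFieldType) (cardF : #|F| = q)
  (L : closedFieldType) (iota : {rmorphism F -> L})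
  (L_alg : forall x : L, algebraicOver iota x)
  (zeta : nat -> L) (zeta_compat : compatible_roots q zeta)
  (s e0 : nat) (ps e : 'I_s -> nat)
  (ps_prime : forall i : 'I_s, prime (ps i))
  (ps_odd : forall i : 'I_s, odd (ps i))
  (ps_neq_p : forall i : 'I_s, ps i != p)
  (ps_inj : injective ps)
  (e0_gt0 : (0 < e0)%N) (e_gt0 : forall i : 'I_s, (0 < e i)%N)
  (eta : 'I_s -> int) (eta_prs : primitive_root_system ps e eta)
  (n : nat) (n_def : n = (2 ^ e0 * \prod_(i < s) ps i ^ e i)%N) :
  [/\ 'X^n - 1 =
        (\prod_(yx in Sigma_plus q ps e) \prod_(d < e0.+1)
           \prod_(t : {ffun 'I_(s_plus q e0 yx.1 d) -> bool})
              factor_plus eta zeta t)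
      * (\prod_(yx in Sigma_minus q ps e) \prod_(d < e0.+1)
           \prod_(t : {ffun 'I_(s_minus q e0 yx.1 d) -> bool})
              factor_minus eta zeta t),
      forall yx, yx \in Sigma_plus q ps e -> forall d, (d <= e0)%N ->
        forall t : {ffun 'I_(s_plus q e0 yx.1 d) -> bool},
          irreducible_over iota (factor_plus eta zeta t)
    & forall yx, yx \in Sigma_minus q ps e -> forall d, (d <= e0)%N ->
        forall t : {ffun 'I_(s_minus q e0 yx.1 d) -> bool},
          irreducible_over iota (factor_minus eta zeta t)].
Proof.
have q_gt1 : (1 < q)%N.
  by rewrite q_def -(exp1n k) ltn_exp2r // prime_gt1.
have q_odd : odd q by rewrite q_def oddX p_odd orbT.
have co_q i : coprime q (ps i).
  by rewrite q_def coprimeXl // prime_coprime // dvdn_prime2 // eq_sym.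
have pl_in yx : (yx \in Sigma_plus q ps e) = (yx \in Sigma q ps e) && is_plus q yx.1.
  by rewrite inE.
have mi_in yx : (yx \in Sigma_minus q ps e)
    = (yx \in Sigma q ps e) && ~~ is_plus q yx.1.
  by rewrite inE is_minusE.
pose w (yx : exps ps e * exps ps e) d := wdeg q e0 yx.1 d.
pose r (yx : exps ps e * exps ps e) d := rord q e0 yx.1 d.
pose h (yx : exps ps e * exps ps e) d := hexp q e0 yx.1 d.
pose sd (yx : exps ps e * exps ps e) d := sdim q e0 yx.1 d.
pose beta (yx : exps ps e * exps ps e) d T : L :=
  zeta (Nord e0 yx.1 d) ^ rep q eta yx d T.
have facE yx d T : yx \in Sigma q ps e -> (d <= e0)%N ->
    factor q zeta (w yx d) (r yx d) (h yx d) (rep q eta yx d T) =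
      \prod_(i < w yx d * h yx d) ('X - (beta yx d T ^+ (q ^ i))%:P) /\
    irreducible_over iota
      (factor q zeta (w yx d) (r yx d) (h yx d) (rep q eta yx d T)).
  move=> yxS de.
  have H1 := esym (rord_hexp q_gt1 q_odd ps_prime ps_odd ps_inj co_q yx.1 de).
  have H2 := coprime_Nord e0 q_odd co_q yx.1 d.
  have H3 := wdeg_gt0 q e0 yx.1 d.
  have H4 := dvdn_Nord q_gt1 q_odd ps_prime ps_odd ps_inj co_q yx.1 de.
  have H5 := rord_dvd e0 q_gt1 q_odd ps_prime ps_odd ps_inj co_q yx.1 d.
  have H6 : coprimez (rep q eta yx d T) (Nord e0 yx.1 d).
    exact: (coset_rep_coprime e0 ps_prime ps_odd ps_inj eta_prs
      (~~ is_plus q yx.1) d T yxS).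
  split.
    exact: (factor_prod_conjugates p_prime q_def cardF zeta_compat H1 H2 H3 H4 H5 H6).
  exact: (factor_irreducible iota p_prime q_def cardF zeta_compat H1 H2 H3 H4 H5 H6).
split; last 2 first.
- move=> yx; rewrite pl_in => /andP[yxS pl] d de t.
  by rewrite factor_plusE //; apply: (facE _ _ _ yxS de).2.
- move=> yx; rewrite mi_in => /andP[yxS mi] d de t.
  by rewrite factor_minusE //; apply: (facE _ _ _ yxS de).2.
pose G yx := \prod_(d < e0.+1) \prod_(T < 2 ^ sd yx d)
  \prod_(i < w yx d * h yx d) ('X - (beta yx d T ^+ (q ^ i))%:P).
have -> : \prod_(yx in Sigma_plus q ps e) \prod_(d < e0.+1)
    \prod_(t : {ffun 'I_(s_plus q e0 yx.1 d) -> bool}) factor_plus eta zeta t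
  = \prod_(yx in Sigma q ps e | is_plus q yx.1) G yx.
  apply: eq_big => [yx|yx]; rewrite pl_in // => /andP[yxS pl].
  apply: eq_bigr => d _; rewrite (eq_bigr _ (fun t _ => factor_plusE eta zeta t pl)).
  rewrite /sd /sdim pl -(big_binary _ _
    (fun T => \prod_(i < w yx d * h yx d) ('X - (beta yx d T ^+ (q ^ i))%:P))).
  by apply: eq_bigr => t _; apply: (facE _ _ _ yxS _).1; rewrite -ltnS.
have -> : \prod_(yx in Sigma_minus q ps e) \prod_(d < e0.+1)
    \prod_(t : {ffun 'I_(s_minus q e0 yx.1 d) -> bool}) factor_minus eta zeta t
  = \prod_(yx in Sigma q ps e | ~~ is_plus q yx.1) G yx.
  apply: eq_big => [yx|yx]; rewrite mi_in // => /andP[yxS mi].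
  apply: eq_bigr => d _; rewrite (eq_bigr _ (fun t _ => factor_minusE eta zeta t mi)).
  rewrite /sd /sdim (negPf mi) -(big_binary _ _
    (fun T => \prod_(i < w yx d * h yx d) ('X - (beta yx d T ^+ (q ^ i))%:P))).
  by apply: eq_bigr => t _; apply: (facE _ _ _ yxS _).1; rewrite -ltnS.
rewrite -bigID /G (sig_big_ord2 _ (fun yx (d : 'I_e0.+1) => 2 ^ sd yx d)%N
  (fun yx (d : 'I_e0.+1) => w yx d * h yx d)%N _
  (fun yx (d : 'I_e0.+1) T i => 'X - (beta yx d T ^+ (q ^ i))%:P)).
have nE : n = (2 ^ e0 * nprime ps e)%N by [].
have d_le (d : 'I_e0.+1) : (d <= e0)%N by rewrite -ltnS.
apply/esym/prod_XsubC_Xn_sub_1.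
- by rewrite nE muln_gt0 expn_gt0 prod_ps_gt0.
- move=> [yx [d [T i]]] [yx' [d' [T' i']]] /= z_in z_in' E.
  have yxS : yx \in Sigma q ps e := z_in; have yxS' : yx' \in Sigma q ps e := z_in'.
  have H2 := coprime_Nord e0 q_odd co_q yx.1 d.
  have H4 := dvdn_Nord q_gt1 q_odd ps_prime ps_odd ps_inj co_q yx.1 (d_le d).
  have H6 : coprimez (rep q eta yx d T) (Nord e0 yx.1 d).
    exact: (coset_rep_coprime e0 ps_prime ps_odd ps_inj eta_prs
      (~~ is_plus q yx.1) d T yxS).
  have per := conjugate_period p_prime q_def zeta_compat H2 H4 H6.
  (* The exponent q^i is undone by completing the period: i + (w h - i) = w h. *)
  have E' : beta yx d T = beta yx' d' T' ^+ (q ^ (i' + (w yx d * h yx d - i))).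
    rewrite expnD exprM -E -exprM -expnD subnKC; last exact/ltnW.
    by rewrite per.
  have [yxE dE TE] := rep_inj q_gt1 q_odd ps_prime ps_odd ps_inj co_q eta_prs
    zeta_compat yxS yxS' (d_le d) (d_le d') (ltn_ord T) (ltn_ord T') E'.
  move: dE => /val_inj dE; subst yx' d'; move: TE => /val_inj TE; subst T'.
  have H1 := esym (rord_hexp q_gt1 q_odd ps_prime ps_odd ps_inj co_q yx.1 (d_le d)).
  have H3 := wdeg_gt0 q e0 yx.1 d.
  have H5 := rord_dvd e0 q_gt1 q_odd ps_prime ps_odd ps_inj co_q yx.1 d.
  have := conjugate_inj p_prime q_def cardF zeta_compat H1 H2 H3 H4 H5 H6
    (ltn_ord i) (ltn_ord i') E.
  by move=> /val_inj ->.
- move=> [yx [d [T i]]] /= yxS; rewrite -exprM mulnC exprM.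
  rewrite (_ : beta yx d T ^+ n = 1) ?expr1n //.
  have /dvdnP[c ->] : (Nord e0 yx.1 d %| n)%N.
    by rewrite nE; apply: Nord_dvd_n => j; apply: (Sigma_le yxS).
  have zN : (Nord e0 yx.1 d).-primitive_root (zeta (Nord e0 yx.1 d)).
    by case: zeta_compat => H _; apply/H/coprime_Nord.
  have betaN := prim_expr_order (prim_exprz zN (coset_rep_coprime e0 ps_prime
    ps_odd ps_inj eta_prs (~~ is_plus q yx.1) d T yxS)).
  by rewrite mulnC exprM [X in X ^+ _]betaN expr1n.
rewrite -sum1_card.
rewrite -(sig_big_ord2 _ (fun yx (d : 'I_e0.+1) => 2 ^ sd yx d)%N
  (fun yx (d : 'I_e0.+1) => w yx d * h yx d)%N (mem (Sigma q ps e))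
  (fun yx (d : 'I_e0.+1) T i => 1%N)).
(* n = 2^e0 n' is split into the sum over d of phi(2^(e0 - d)) times the sum over [Sigma] of tau,
   matched term by term with [count_factors]. *)
rewrite nE -(sum_totient_pfactor e0 (isT : prime 2)).
rewrite -(sum_tau_Sigma e q_gt1 ps_prime co_q) big_distrr /=.
apply: eq_bigr => yx yxS; rewrite big_distrl /=; apply: eq_bigr => d _.
rewrite -(count_factors q_gt1 q_odd ps_prime ps_odd ps_inj co_q yx.1 (d_le d)).
under eq_bigr => T _ do rewrite sum1_card card_ord.
by rewrite sum_nat_const card_ord.
Qed.
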